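(* Let $d\ge2$ and $k\ge1$ be integers. There is a constant $c=c(k,d)>0$ such that the following holds. (a) Let $1\le p<q<\infty$ be such that $s:=d\left(\frac1p-\frac1q\right)$ satisfies $0<s\le k$. For every $f\in V_{pq}^k$ and $N\in\mathbb N$ there exist a covering $\Delta_N$ of $Q^d=[0,1)^d$ by dyadic subcubes of $Q^d$ with $\operatorname{card}\Delta_N\le N$ and $g_N\in\mathcal P_{k-1}(\Delta_N)$ such that $$\|f-g_N\|_{L_q(Q^d)}\le c\,N^{-s/d}|f|_{V_{pq}^k}.$$ The same is true for $q=\infty$ (i.e. $1\le p<\infty$, $s/d=1/p$, $0<s\le k$) if, in addition, $f$ is uniformly continuous on $Q^d$. (b) In (a) the covering $\Delta_N$ can be replaced by a partition of $Q^d$ into at most $N$ dyadic $d$-rings (with $g_N$ a piecewise polynomial of degree $k-1$ over this partition).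
   Context: A cube is a set homothetic to $Q^d:=[0,1)^d$, i.e. of the form $a+r[0,1)^d$, $a\in\mathbb R^d$, $r>0$. Dyadic subcubes of $Q^d$ are the cubes $2^{-j}(Q^d+\alpha)\subset Q^d$, $j\in\{0,1,2,\dots\}$, $\alpha\in\mathbb Z^d$. A dyadic $d$-ring is a difference $Q'\setminus Q''$ of two dyadic subcubes $Q''\subsetneq Q'$ of $Q^d$, where $Q''=\emptyset$ is allowed. $\mathcal P_{l}$ is the space of polynomials on $\mathbb R^d$ of degree at most $l$. For a finite family $\Delta$ of sets, $\mathcal P_l(\Delta)$ is the set of functions $\sum_{K\in\Delta}P_K\cdot 1_K$ with $P_K\in\mathcal P_l$. For a measurable set $S$, $E_k(f;S;L_q):=\inf_{m\in\mathcal P_{k-1}}\|f-m\|_{L_q(S)}$. The space $V_{pq}^k=V_{pq}^k(Q^d)$ consists of all $f\in L_q(Q^d)$ with finite seminorm $$|f|_{V_{pq}^k}:=\sup_\Delta\Big\{\sum_{Q\in\Delta}E_k(f;Q;L_q)^p\Big\}^{1/p},$$ where $\Delta$ runs over all families of pairwise disjoint cubes $Q\subset Q^d$. (Up to equivalence, $E_k(f;Q;L_q)$ may be replaced by $\sup_h\|\Delta_h^kf\|_{L_q(Q_{kh})}$, $Q_{kh}=\{x: x+jh\in Q,\ j=0,\dots,k\}$.) *)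

(* Defs.v *)
From HB Require Import structures.
From mathcomp Require Import all_boot all_order all_algebra.
From mathcomp Require Import -(notations) mpoly.
From mathcomp Require Import all_classical all_reals all_analysis.
Import Order.TTheory GRing.Theory Num.Theory.
Import numFieldNormedType.Exports.

Set Implicit Arguments.
Unset Strict Implicit.
Unset Printing Implicit Defensive.

Local Open Scope classical_set_scope.
Local Open Scope ring_scope.

(* The space R^n is the type of n-tuples of reals, with the product of the Borel
   sigma-algebras of the factors. *)
Notation euclid R n := (n.-tuple (measurableTypeR R)).

(* The Lebesgue measure on R^n, by recursion on n: on R^0 it is the Dirac mass
   at the only point; on R^n.+1 it is the image of the product of the Lebesgue
   measures of R and R^n by (x, t) |-> x :: t. *)
Definition euclid_cons {R : realType} {n : nat}
    (z : measurableTypeR R * euclid R n) : euclid R n.+1 :=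
  [tuple of z.1 :: z.2].

Lemma measurable_euclid_cons {R : realType} {n : nat} :
  measurable_fun [set: measurableTypeR R * euclid R n] euclid_cons.
Proof. exact: measurable_cons. Qed.

Section lebesgue_succ.
Context {R : realType} {n : nat}.
Variable mu : {sigma_finite_measure set (euclid R n) -> \bar R}.

Definition lebesgue_succ : set (euclid R n.+1) -> \bar R :=
  pushforward (@lebesgue_measure R \x mu)%E euclid_cons.

Let lebesgue_succ0 : lebesgue_succ set0 = 0%E.
Proof. by rewrite /lebesgue_succ /pushforward preimage_set0 measure0. Qed.

Let lebesgue_succ_ge0 A : (0 <= lebesgue_succ A)%E.
Proof. by rewrite /lebesgue_succ /pushforward measure_ge0. Qed.

Let lebesgue_succ_sigma_additive : semi_sigma_additive lebesgue_succ.
Proof.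
move=> F mF tF mUF; rewrite /lebesgue_succ /pushforward preimage_bigcup.
apply: measure_semi_sigma_additive.
- by move=> i; rewrite -[X in measurable X]setTI; exact: measurable_euclid_cons.
- apply/trivIsetP => /= i j _ _ ij; rewrite -preimage_setI.
  by move/trivIsetP : tF => /(_ _ _ _ _ ij) ->//; rewrite preimage_set0.
- rewrite -preimage_bigcup -[X in measurable X]setTI.
  exact: measurable_euclid_cons.
Qed.

HB.instance Definition _ := isMeasure.Build _ _ _ lebesgue_succ
  lebesgue_succ0 lebesgue_succ_ge0 lebesgue_succ_sigma_additive.

Let lebesgue_succ_sigma_finite : sigma_finite setT lebesgue_succ.
Proof.
have /sigma_finiteP[F [FT ndF mF]] := sigma_finiteT (@lebesgue_measure R).
have /sigma_finiteP[G [GT ndG mG]] := sigma_finiteT mu.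
pose h (t : euclid R n.+1) : measurableTypeR R * euclid R n :=
  (thead t, [tuple of behead t]).
have mh : measurable_fun setT h.
  apply/measurable_fun_pairP; split; last exact: measurable_behead.
  exact: measurable_tnth.
have consK : cancel euclid_cons h.
  by move=> [x t]; rewrite /h theadE; congr pair; exact/val_inj.
exists (fun i => h @^-1` (F i `*` G i)).
  rewrite -preimage_bigcup (_ : \bigcup_i _ = setT) ?preimage_setT//.
  apply/seteqP; split => // -[x y] _.
  have [i _ Fix] : (\bigcup_i F i) x by rewrite -FT.
  have [j _ Gjy] : (\bigcup_i G i) y by rewrite -GT.
  exists (maxn i j) => //; split => /=.
  - by move: x Fix; exact/subsetPset/ndF/leq_maxl.
  - by move: y Gjy; exact/subsetPset/ndG/leq_maxr.
move=> i; have [mFi Fioo] := mF i; have [mGi Gioo] := mG i; split.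
  by rewrite -[X in measurable X]setTI; apply: mh => //; exact: measurableX.
rewrite /lebesgue_succ /pushforward -comp_preimage.
rewrite (_ : h \o _ = idfun); last by apply/funext => z /=; rewrite consK.
by rewrite preimage_id product_measure1E// lte_mul_pinfty// ge0_fin_numE.
Qed.

HB.instance Definition _ := @Measure_isSigmaFinite.Build _ _ _ lebesgue_succ
  lebesgue_succ_sigma_finite.

End lebesgue_succ.

Fixpoint lebesgue_euclid (R : realType) (n : nat) :
    {sigma_finite_measure set (euclid R n) -> \bar R} :=
  match n with
  | 0 => \d_([tuple] : euclid R 0)
  | m.+1 => lebesgue_succ (lebesgue_euclid R m)
  end.

Section approximation.
Context {R : realType} {d : nat}.
Implicit Types (S Q K : set (euclid R d)) (D : set (set (euclid R d)))
  (f g : euclid R d -> R) (p : R) (q : \bar R) (l k N : nat).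

Definition cube (a : euclid R d) (r : R) : set (euclid R d) :=
  [set x | forall i : 'I_d, tnth a i <= tnth x i < tnth a i + r].

Definition is_cube Q := exists a r, 0 < r /\ Q = cube a r.

Definition unit_cube : set (euclid R d) := cube [tuple 0 | i < d] 1.

Definition dyadic_cube (j : nat) (alpha : d.-tuple int) : set (euclid R d) :=
  cube [tuple 2 ^- j * (tnth alpha i)%:~R | i < d] (2 ^- j).

Definition is_dyadic_subcube Q :=
  exists j alpha, Q = dyadic_cube j alpha /\ Q `<=` unit_cube.

Definition is_dyadic_ring K :=
  exists Q' Q'', [/\ is_dyadic_subcube Q',
    Q'' = set0 \/ is_dyadic_subcube Q'', Q'' `<` Q' & K = Q' `\` Q''].

(* mpoly.msize is 1 + the total degree, and 0 for the zero polynomial. *)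
Definition polys l : set (mpoly.mpoly d R) :=
  [set P : mpoly.mpoly d R | (mpoly.msize P <= l.+1)%N].

Definition peval (P : mpoly.mpoly d R) (x : euclid R d) : R :=
  mpoly.meval (tnth x) P.

Definition piecewise_polys l D : set (euclid R d -> R) :=
  [set g | exists2 P : set (euclid R d) -> mpoly.mpoly d R,
     forall K, D K -> polys l (P K) &
     forall x, g x = \sum_(K \in D) peval (P K) x * \1_K x].

(* The L_q norm over S (ess sup for q = +oo) is that of the extension by 0. *)
Definition normLq q S f : \bar R :=
  Lnorm (lebesgue_euclid R d) q (fun x => (f x * \1_S x)%:E).

Definition best_approx k f S q : \bar R :=
  ereal_inf [set normLq q S (fun x => f x - peval m x) | m in polys k.-1].

Definition disjoint_cubes : set (set (set (euclid R d))) :=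
  [set D | (forall Q, D Q -> is_cube Q /\ Q `<=` unit_cube) /\ trivIset D id].

Definition seminormV p q k f : \bar R :=
  ereal_sup [set (\esum_(Q in D) best_approx k f Q q `^ p) `^ p^-1
            | D in disjoint_cubes]%E.

Definition spaceV p q k : set (euclid R d -> R) :=
  [set f | [/\ measurable_fun unit_cube f,
    (normLq q unit_cube f < +oo)%E & (seminormV p q k f < +oo)%E]].

Definition unif_continuous_on S f := forall e : R, 0 < e -> exists2 delta : R,
  0 < delta & forall x y, S x -> S y ->
    (forall i, `|tnth x i - tnth y i| < delta) -> `|f x - f y| < e.

Definition dyadic_covering N D :=
  [/\ forall Q, D Q -> is_dyadic_subcube Q, \bigcup_(Q in D) Q = unit_cube
    & (D #<= `I_N)%card].

Definition ring_partition N D :=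
  [/\ forall K, D K -> is_dyadic_ring K, \bigcup_(K in D) K = unit_cube,
    trivIset D id & (D #<= `I_N)%card].

End approximation.

(* Main.v *)
(* The whole proof rests on three observations.

   A polynomial m of degree < k satisfies m(x) = sum_(1 <= j <= k) c_j m(x + j h),
   so translation invariance of the L_q norm bounds the norm of m over a slab by
   its norm over an adjacent box, with a constant independent of q.  Iterating,
   norms of m over comparable boxes are comparable, and near-best polynomials of f
   on two sets which overlap in a box can be glued to one polynomial on the union.

   In dimension d >= 2 a dyadic ring is connected, and it is a union of at most 2d
   boxes of bounded eccentricity, any two of transversal directions overlapping in a
   box comparable to the smaller one.  Hence f is approximated on a ring by a single
   polynomial as well as on the worst of the cubes contained in the ring.

   Call a set bad if it contains a cube whose best approximation exceeds
   eps = |f|_V M^(-1/p); disjoint bad sets are at most M in number.  In a dyadic cube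
   Q choose a smallest dyadic cube Q* such that Q \ Q* is not bad, and continue in
   the children Q_i of Q*: either two of them are bad, or Q \ Q_i is bad for the
   only bad child.  Thus O(M) good rings suffice, and the error is at most
   (sum t_K^q)^(1/q) with t_K <= eps and sum t_K^p <= |f|_V^p.  A partition into
   rings gives a covering by twice as many cubes since 1_(Q' \ Q'') = 1_Q' - 1_Q''. *)

Require Import Defs.
From HB Require Import structures.
From mathcomp Require Import all_boot all_order all_algebra.
From mathcomp Require Import -(notations) mpoly.
From mathcomp Require Import ring lra zify.
From mathcomp Require Import all_classical all_reals all_analysis.
From mathcomp Require Import measurable_realfun ess_sup_inf measurable_fun_approximation.
Import Order.TTheory GRing.Theory Num.Theory.
Import numFieldNormedType.Exports.

Set Implicit Arguments.
Unset Strict Implicit.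
Unset Printing Implicit Defensive.

Local Open Scope classical_set_scope.
Local Open Scope ring_scope.

(** * Norms over subsets *)

Section norm.
Context {R : realType} {d : nat}.
Implicit Types (S : set (euclid R d)) (f g : euclid R d -> R) (q : \bar R).
Local Notation mu := (lebesgue_euclid R d).

(** Subdividing bad cubes dyadically gives no count: a long chain of cubes, each with a single bad
    child, costs many pieces for one bad cube. Removing the whole chain at once produces the ring Q
    \ Q*, and the price is approximation by one polynomial on a set that is not convex. Badness is
    tested on all cubes, not only dyadic ones, because the slabs of a ring are built from cubes in
    arbitrary position; the seminorm allows such cubes. The chains end because best approximation is
    small on all small cubes, by absolute continuity of the integral for finite q and by uniform
    continuity for q = oo. The depth reached depends on f but enters no constant. A factor 2
    separates a best approximation from one realized by a polynomial, which is no help when the best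
    approximation is 0; there the infimum must be attained, and this is why polynomials are shown to
    form a closed space. The rate comes from t^q <= eps^(q-p) t^p and eps^p = |f|_V^p / M, which
    give eps^(q-p) |f|_V^p = (|f|_V M^(-(1/p-1/q)))^q. *)

Lemma normLq_congr q S f g : (forall x, S x -> f x = g x) ->
  normLq q S f = normLq q S g.
Proof.
move=> fg; apply: eq_Lnorm => x; congr EFin.
have [Sx|Sx] := pselect (S x); first by rewrite fg.
by rewrite indicE memNset// !mulr0.
Qed.

Lemma normLq_ge0 q S f : (0 <= normLq q S f)%E.
Proof. exact: Lnorm_ge0. Qed.

Lemma normLqN q S f : normLq q S (fun x => - f x) = normLq q S f.
Proof.
rewrite /normLq -[RHS]oppe_Lnorm; apply: eq_Lnorm => x.
by rewrite /= mulNr.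
Qed.

Lemma measurable_mul_indic S f : measurable S -> measurable_fun setT f ->
  measurable_fun setT (fun x => f x * \1_S x).
Proof. by move=> mS mf; apply: measurable_funM => //; exact: measurable_indic. Qed.

Lemma normLqD q S f g : measurable S -> measurable_fun setT f ->
  measurable_fun setT g -> (1 <= q)%E ->
  (normLq q S (fun x => f x + g x)%R <= normLq q S f + normLq q S g)%E.
Proof.
move=> mS mf mg q1.
apply: le_trans (eminkowski _ (measurable_mul_indic mS mf)
  (measurable_mul_indic mS mg) q1).
by rewrite /normLq le_eqVlt; apply/orP; left; apply/eqP/eq_Lnorm => x /=; rewrite mulrDl.
Qed.

Let measurable_normr_powR f r : measurable_fun setT f ->
  measurable_fun setT (fun x => `|f x| `^ r).
Proof.
move=> mf; apply: (@measurableT_comp _ _ _ _ _ _ (@powR R ^~ r)) => //.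
exact: measurableT_comp.
Qed.

Lemma le_normLq q S S' f g : measurable S -> measurable S' ->
  measurable_fun setT f -> measurable_fun setT g -> (1 <= q)%E ->
  (forall x, `|f x * \1_S x| <= `|g x * \1_S' x|) ->
  (normLq q S f <= normLq q S' g)%E.
Proof.
move=> mS mS' mf mg; rewrite /normLq unlock /=.
case: q => [r||//]; last first.
  move=> _ fg; case: ifPn => // _; apply: le_ess_sup; apply: nearW => x /=.
  by rewrite lee_fin.
rewrite lee_fin => r1 fg.
have r0 : 0 < r by exact: lt_le_trans r1.
apply: gt0_ler_poweR.
- by rewrite invr_ge0 ltW.
- by rewrite in_itv/= leey andbT; apply: integral_ge0 => x _; rewrite lee_fin powR_ge0.
- by rewrite in_itv/= leey andbT; apply: integral_ge0 => x _; rewrite lee_fin powR_ge0.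
apply: ge0_le_integral => //=.
- by apply/measurable_EFinP; apply: measurable_normr_powR; exact: measurable_mul_indic.
- by apply/measurable_EFinP; apply: measurable_normr_powR; exact: measurable_mul_indic.
- by move=> x _; rewrite lee_fin ge0_ler_powR// ltW.
Qed.

Lemma normLqS q S S' f : measurable S -> measurable S' ->
  measurable_fun setT f -> (1 <= q)%E -> S `<=` S' ->
  (normLq q S f <= normLq q S' f)%E.
Proof.
move=> mS mS' mf q1 SS'; apply: le_normLq => // x.
rewrite !normrM ler_wpM2l// !indicE.
have [Sx|Sx] := pselect (S x); first by rewrite !mem_set//; exact: SS'.
by rewrite memNset// normr0.
Qed.

Lemma normLqU q S S' f : measurable S -> measurable S' ->
  measurable_fun setT f -> (1 <= q)%E ->
  (normLq q (S `|` S') f <= normLq q S f + normLq q S' f)%E.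
Proof.
move=> mS mS' mf q1.
have mSS' : measurable (S' `\` S) by exact: measurableD.
have -> : normLq q (S `|` S') f =
    normLq q setT (fun x => f x * \1_S x + f x * \1_(S' `\` S) x).
  apply: eq_Lnorm => x; rewrite indicT mulr1 -mulrDr !indicE in_setU in_setD.
  by case: (x \in S); case: (x \in S'); rewrite /= ?addr0 ?add0r.
apply: le_trans (normLqD _ _ _ q1) _ => //; [exact: measurable_mul_indic|exact: measurable_mul_indic|].
apply: leeD.
  by rewrite le_eqVlt; apply/orP; left; apply/eqP/eq_Lnorm => x; rewrite indicT mulr1.
have -> : normLq q setT (fun x => f x * \1_(S' `\` S) x) = normLq q (S' `\` S) f.
  by apply: eq_Lnorm => x; rewrite indicT mulr1.
by apply: normLqS => // x [].
Qed.

Lemma normLqZ q S f (c : R) : measurable S -> measurable_fun setT f -> (1 <= q)%E ->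
  normLq q S (fun x => c * f x) = (`|c|%:E * normLq q S f)%E.
Proof.
move=> mS mf; rewrite /normLq unlock /=.
case: q => [r||//]; last first.
  move=> _; case: ifPn => mu0; last by rewrite mule0.
  rewrite -ess_supZl//; congr ess_sup; apply/funext => x /=.
  by rewrite -mulrA normrM.
rewrite lee_fin => r1; have r0 : 0 < r by exact: lt_le_trans r1.
under eq_integral => x _ do
  rewrite -mulrA normrM powRM// EFinM.
rewrite ge0_integralZl_EFin//=; last first.
  by apply/measurable_EFinP; apply: measurable_normr_powR; exact: measurable_mul_indic.
rewrite poweRM ?lee_fin ?powR_ge0//; last first.
  by apply: integral_ge0 => x _; rewrite lee_fin powR_ge0.
by rewrite poweR_EFin -powRrM divff ?gt_eqF// powRr1.
Qed.

Lemma poweR_normLq (r : R) S f : 0 < r ->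
  (normLq r%:E S f `^ r)%E = (\int[mu]_x ((`|f x * \1_S x| `^ r)%:E))%E.
Proof. by move=> r0; rewrite /normLq poweR_Lnorm ?gt_eqF. Qed.

(** [Lnorm] at [+oo] is an essential supremum when the whole space has positive measure and 0
    otherwise, whence the first alternative. *)
Lemma normLq_infty_le S f (M : R) : 0 <= M ->
  (normLq +oo%E S f <= M%:E)%E <->
  (mu setT = 0 \/ \forall x \ae mu, `|f x * \1_S x| <= M).
Proof.
move=> M0; rewrite /normLq unlock; case: ifPn => [mu0|]; last first.
  rewrite lt0e measure_ge0 andbT negbK => /eqP ->; rewrite lee_fin M0.
  by split => //; left.
split.
  by move=> /ess_supP h; right; apply: filterS h => x /=; rewrite lee_fin.
case=> [h|h]; first by move: mu0; rewrite lt0e => /andP[/eqP/(_ h)].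
by apply/ess_supP; apply: filterS h => x /=; rewrite lee_fin.
Qed.

Lemma normLq_bigU_fin (r : R) (I : choiceType) (s : seq I) (F : I -> set (euclid R d)) f :
  0 < r -> measurable_fun setT f -> (forall i, i \in s -> measurable (F i)) ->
  (forall x i j, i \in s -> j \in s -> F i x -> F j x -> i = j) -> uniq s ->
  (normLq r%:E (\big[setU/set0]_(i <- s) F i) f `^ r
   = \sum_(i <- s) normLq r%:E (F i) f `^ r)%E.
Proof.
move=> r0 mf; elim: s => [_ _ _|i s IH mF dF /= /andP[is_ us]].
  rewrite !big_nil poweR_normLq// integral0_eq// => x _.
  by rewrite indic0 mulr0 normr0 powR0 // gt_eqF.
have mFi : measurable (F i) by apply: mF; rewrite mem_head.
have mFs j : j \in s -> measurable (F j) by move=> js; apply: mF; rewrite inE js orbT.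
rewrite !big_cons -IH//; last first.
  by move=> x j k js ks; apply: dF; rewrite inE ?js ?ks orbT.
rewrite !poweR_normLq// -ge0_integralD//=; last 2 first.
- by apply/measurable_EFinP; apply: measurable_normr_powR; exact: measurable_mul_indic.
- apply/measurable_EFinP; apply: measurable_normr_powR; apply: measurable_mul_indic => //.
  by rewrite big_seq; elim/big_ind : _ => // *; exact: measurableU.
apply: eq_integral => x _; rewrite -EFinD; congr EFin.
have [Fx|Fx] := pselect (F i x).
  rewrite [X in _ = _ + X](_ : _ = 0) ?addr0; last first.
    rewrite indicE memNset ?mulr0 ?normr0 ?powR0 ?gt_eqF//.
    rewrite -bigcup_seq => -[j js Fjx].
    have ij : i = j by apply: (dF x) => //; rewrite inE ?eqxx// js orbT.
    by move: is_; rewrite ij js.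
  by rewrite !indicE !mem_set//; left.
rewrite [X in _ = X + _](_ : _ = 0) ?add0r; last first.
  by rewrite indicE memNset// mulr0 normr0 powR0// gt_eqF.
rewrite !indicE in_setU; congr (`|_ * _| `^ _).
by rewrite memNset.
Qed.

Lemma normLq_bigU_infty (I : eqType) (s : seq I) (F : I -> set (euclid R d)) f (M : R) :
  0 <= M -> (forall i, i \in s -> normLq +oo%E (F i) f <= M%:E)%E ->
  (normLq +oo%E (\big[setU/set0]_(i <- s) F i) f <= M%:E)%E.
Proof.
move=> M0 H; apply/normLq_infty_le => //.
have [muT|muT] := pselect (mu setT = 0); first by left.
right; elim: s H => [|i s IH] H.
  by apply: nearW => x; rewrite big_nil indic0 mulr0 normr0.
have [//|Hi] := (normLq_infty_le (F i) f M0).1 (H i (mem_head _ _)).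
have {}IH := IH (fun j js => H j (mem_behead (s := i :: s) js)).
apply: filterS2 IH Hi => x; rewrite big_cons !indicE in_setU.
by case: (x \in F i) => //=; case: (x \in _).
Qed.

End norm.

(** * Boxes, translations and the measure of cubes *)

Section boxes.
Context {R : realType} {d : nat}.
Implicit Types (u v : 'I_d -> R).

(** Corners are functions, so that one coordinate can be changed at a time; [v i <= u i] is allowed
    and makes the box empty. *)
Definition box u v : set (euclid R d) := [set x | forall i, u i <= tnth x i < v i].

Lemma measurable_box u v : measurable (box u v).
Proof.
rewrite (_ : box u v = \big[setI/setT]_(i <- enum 'I_d)
    ((fun x : euclid R d => tnth x i) @^-1` `[u i, v i[%classic)).
  elim/big_ind : _ => //; first by move=> *; exact: measurableI.
  move=> i _; rewrite -[X in measurable X]setTI; exact: measurable_tnth.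
rewrite -bigcap_seq; apply/seteqP; split => x /=.
  by move=> H i _; rewrite /= in_itv/=; exact: H.
by move=> H i; have := H i; rewrite /= in_itv/=; apply; rewrite mem_enum.
Qed.

Lemma cube_box (a : euclid R d) r : cube a r = box (tnth a) (fun i => tnth a i + r).
Proof. by []. Qed.

Lemma box_cube u v (r : R) : (forall i, v i - u i = r) -> box u v = cube [tuple u i | i < d] r.
Proof.
by move=> H; apply/seteqP; split => x Hx i; have := Hx i; rewrite ?tnth_mktuple -(H i) addrC subrK.
Qed.

Lemma subset_box u v u' v' : (forall i, u' i <= u i) -> (forall i, v i <= v' i) ->
  box u v `<=` box u' v'.
Proof.
move=> uu vv x Hx i; have /andP[ux xv] := Hx i.
by rewrite (le_trans (uu i) ux) (lt_le_trans xv (vv i)).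
Qed.

End boxes.

Section translation.
Context {R : realType}.

Definition translate {d} (h x : euclid R d) : euclid R d :=
  [tuple (tnth x i + tnth h i : R) | i < d].

Lemma measurable_translate d (h : euclid R d) : measurable_fun setT (translate h).
Proof.
apply/measurable_fun_tnthP => i.
rewrite (_ : _ \o _ = fun x : euclid R d => (tnth x i + tnth h i : R)); last first.
  by apply/funext => x; rewrite /= tnth_mktuple.
apply: (@measurable_funD _ _ R); last exact: measurable_cst.
exact: measurable_tnth.
Qed.

Let addh (h : R) : measurableTypeR R -> measurableTypeR R := fun x : R => x + h.

(** The image measure and the Lebesgue measure agree on half-open intervals, and uniqueness does the
    rest. *)
Lemma lebesgue_measure_translate (h : R) (A : set R) : measurable A ->
  lebesgue_measure ((fun x => x + h) @^-1` A) = lebesgue_measure A.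
Proof.
move=> mA.
have mh : measurable_fun setT (addh h : measurableTypeR R -> measurableTypeR R).
  exact: (@measurable_funD _ _ R).
pose hp : {mfun measurableTypeR R >-> measurableTypeR R} :=
  HB.pack (addh h) (isMeasurableFun.Build _ _ _ _ _ mh).
apply/esym/(@lebesgue_measure_unique _ (pushforward lebesgue_measure hp)) => //.
move=> _ [[a b]] _ <-; transitivity (lebesgue_measure `]a - h, b - h]%classic); last first.
  congr (lebesgue_measure _).
  by apply/seteqP; split => x /=; rewrite !in_itv/= /addh ltrBlDr lerBrDr.
rewrite !lebesgue_measure_itv /= !lte_fin ltrD2r.
by rewrite -!EFinB opprB addrA subrK.
Qed.

Lemma ge0_integral_translate1 (h : R) (f : measurableTypeR R -> \bar R) :
  measurable_fun setT f -> (forall x, 0 <= f x)%E ->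
  (\int[lebesgue_measure]_x f (addh h x) = \int[lebesgue_measure]_x f x)%E.
Proof.
move=> mf f0.
have mh : measurable_fun setT (addh h : measurableTypeR R -> measurableTypeR R).
  exact: (@measurable_funD _ _ R).
pose hp : {mfun measurableTypeR R >-> measurableTypeR R} :=
  HB.pack (addh h) (isMeasurableFun.Build _ _ _ _ _ mh).
have := @ge0_integral_pushforward _ _ _ _ R hp mh lebesgue_measure setT f measurableT mf
  (fun y _ => f0 y).
rewrite preimage_setT => <-.
by apply: eq_measure_integral => A mA _; rewrite -[RHS](lebesgue_measure_translate h).
Qed.

Lemma lebesgue_euclidS d (A : set (euclid R d.+1)) :
  lebesgue_euclid R d.+1 A =
  (\int[lebesgue_measure]_x lebesgue_euclid R d (xsection (euclid_cons @^-1` A) x))%E.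
Proof. by []. Qed.

(** Induction on the dimension: the section at [x] of the preimage is a translated section of [A] at
    [x + thead h], so the two integrals of sections are matched by a one-dimensional translation. *)
Lemma lebesgue_euclid_translate d (h : euclid R d) A : measurable A ->
  lebesgue_euclid R d (translate h @^-1` A) = lebesgue_euclid R d A.
Proof.
elim: d h A => [|d IH] h A mA.
  by congr (lebesgue_euclid _ _ _); apply/seteqP; split => x /=; rewrite (tuple0 x) (tuple0 (translate _ _)).
have mcA : measurable (euclid_cons @^-1` A).
  by rewrite -[X in measurable X]setTI; exact: measurable_euclid_cons.
rewrite !lebesgue_euclidS -[RHS](ge0_integral_translate1 (thead h)); last 2 first.
- exact: measurable_fun_xsection.
- by move=> x; exact: measure_ge0.
apply: eq_integral => x _.
rewrite -[RHS](IH [tuple of behead h]); last exact: measurable_xsection.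
congr (lebesgue_euclid _ _ _); apply/seteqP; split => y /=;
  rewrite /xsection/= !inE/=; rewrite (_ : translate h (euclid_cons (x, y)) =
    euclid_cons (addh (thead h) x, translate [tuple of behead h] y)) //.
all: apply: eq_from_tnth => i; rewrite tnth_mktuple.
all: case: (unliftP ord0 i) => [j|] ->; rewrite ?tnth0 ?tnthS//= ?tnth_mktuple.
all: rewrite tnth_behead; congr (_ + tnth h _); apply/val_inj => /=.
all: by rewrite inordK// ltnS.
Qed.

Lemma lebesgue_cube d (a : euclid R d) (r : R) : 0 < r ->
  lebesgue_euclid R d (cube a r) = (r ^+ d)%:E.
Proof.
move=> r0; elim: d a => [|d IH] a.
  rewrite expr0 /= diracE mem_set//; by case.
pose a' : euclid R d := [tuple of behead a].
have behead_lift i : tnth a' i = tnth a (lift ord0 i).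
  by rewrite tnth_behead; congr tnth; apply/val_inj => /=; rewrite inordK// ltnS.
have cE : euclid_cons @^-1` cube a r =
    `[thead a, thead a + r[%classic `*` cube a' r.
  apply/seteqP; split => -[x t] /=.
    move=> H; split => /=.
      by have := H ord0; rewrite tnth0 in_itv.
    by move=> i; have := H (lift ord0 i); rewrite behead_lift tnthS.
  move=> [/= xa ta] i; case: (unliftP ord0 i) => [j|] ->.
    by rewrite -behead_lift tnthS; exact: ta.
  by rewrite tnth0; move: xa; rewrite in_itv.
have mc : measurable (cube a' r) by rewrite cube_box; exact: measurable_box.
rewrite /= /lebesgue_succ /pushforward cE product_measure1E//= IH.
rewrite lebesgue_measure_itv /= lte_fin ltrDl r0 -EFinB -EFinM exprS.
by congr (_ * _)%:E; rewrite addrC addKr.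
Qed.

End translation.

Section translation_norm.
Context {R : realType} {d : nat}.
Local Notation mu := (lebesgue_euclid R d).

Lemma normLq_translate (q : \bar R) (S : set (euclid R d)) (f : euclid R d -> R) (h : euclid R d) :
  measurable S -> measurable_fun setT f -> (1 <= q)%E ->
  normLq q (translate h @^-1` S) (f \o translate h) = normLq q S f.
Proof.
move=> mS mf; have mh := measurable_translate h.
pose g x := f x * \1_S x.
have mg : measurable_fun setT g by exact: measurable_mul_indic.
have -> : normLq q (translate h @^-1` S) (f \o translate h) =
    Lnorm mu q (fun x => (g (translate h x))%:E) by apply: eq_Lnorm => x.
rewrite -[RHS]/(Lnorm mu q (fun x => (g x)%:E)) unlock /=.
case: q => [r||//]; last first.
  move=> _; rewrite !ess_supEmu0; last 2 first.
  - by apply: measurableT_comp => //; exact/measurable_EFinP.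
  - apply: measurableT_comp => //; apply/measurable_EFinP.
    exact: measurableT_comp.
  (* The essential supremum is the infimum of the levels whose superlevel set is null, and
     translation preserves the measure of these sets. *)
  congr (if _ then ereal_inf _ else _); apply/seteqP; split => y /=.
    move=> <-; rewrite -[LHS](lebesgue_euclid_translate h)//.
    rewrite -[X in measurable X]setTI; apply: measurableT_comp => //.
      exact/measurable_EFinP.
    exact: emeasurable_itv.
  move=> <-; rewrite -[RHS](lebesgue_euclid_translate h)//.
  rewrite -[X in measurable X]setTI; apply: measurableT_comp => //.
    exact/measurable_EFinP.
  exact: emeasurable_itv.
move=> _; congr (_ `^ _)%E.
pose hp : {mfun euclid R d >-> euclid R d} :=
  HB.pack (translate h) (@isMeasurableFun.Build _ _ (euclid R d) (euclid R d) _ mh).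
have mgr : measurable_fun setT (fun x => (`|g x| `^ r)%:E).
  apply/measurable_EFinP; apply: (@measurableT_comp _ _ _ _ _ _ (@powR R ^~ r)) => //.
  exact: measurableT_comp.
have := @ge0_integral_pushforward _ _ _ _ R hp mh mu setT _ measurableT mgr
  (fun y _ => powR_ge0 _ _).
rewrite preimage_setT => <-.
by apply: eq_measure_integral => A mA _; rewrite -[RHS](lebesgue_euclid_translate h).
Qed.

End translation_norm.

(** * Extrapolation of polynomials in one variable *)

Section poly_extrapolation.
Context {R : realType}.

(** The leading coefficients of p(X + 1) and p agree, so the top term cancels. *)
Let size_diff (p : {poly R}) (k : nat) : (size p <= k.+1)%N ->
  (size (p \Po ('X + 1) - p)%R <= k)%N.
Proof.
move=> pk.
have s2 : size ('X + 1 : {poly R}) = 2%N by rewrite -[1]opprK -polyC1 -polyCN size_XsubC.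
have sc : size (p \Po ('X + 1)) = size p by rewrite size_comp_poly2.
apply/leq_sizeP => j kj; rewrite coefB.
have [jk|kj'] := ltnP k j.
  by rewrite !nth_default ?subrr// ?sc (leq_trans pk).
have {kj kj'}-> : j = k by apply/eqP; rewrite eqn_leq kj kj'.
have [pk'|pk'] := eqVneq (size p) k.+1; last first.
  have {}pk : (size p <= k)%N by rewrite -ltnS ltn_neqAle pk' pk.
  by rewrite !nth_default ?subrr// sc.
have s2' : (1 < size ('X + 1 : {poly R})%R)%N by rewrite s2.
have := lead_coef_comp p s2'.
rewrite /lead_coef sc s2 pk' /= => ->.
by rewrite coefD coefX coef1 /= addr0 expr1n mulr1 subrr.
Qed.

(** Induction on [k] through p(0) = p(1) - (p(1) - p(0)), where the forward difference has lower
    degree. The coefficients are (-1)^j binom(k, j+1): the vanishing of the k-th difference at 0,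
    solved for p(0). *)
Lemma poly_extrapolation (k : nat) : exists c : nat -> R, forall p : {poly R},
  (size p <= k)%N -> p.[0] = \sum_(j < k) c j * p.[j.+1%:R].
Proof.
elim: k => [|k [c IH]].
  exists (fun=> 0) => p; rewrite leqn0 size_poly_eq0 => /eqP ->.
  by rewrite horner0 big_ord0.
(* p(1) gives the first term; - c_j (p(j+2) - p(j+1)) gives the other two, the last one after an
   index shift. *)
exists (fun j => (j == 0%N)%:R + (if (j < k)%N then c j else 0)
  - (if (0 < j)%N then c j.-1 else 0)).
move=> p pk; have /IH := size_diff pk.
have hE t : (p \Po ('X + 1) - p).[t] = p.[t + 1] - p.[t].
  by rewrite hornerD hornerN horner_comp !hornerE.
rewrite hE add0r => /eqP; rewrite subr_eq => /eqP.
under eq_bigr => j _ do rewrite hE natr1 mulrBr.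
rewrite sumrB => E.
have -> : p.[0] = p.[1] - (p.[1] - p.[0]) by rewrite opprB addrC subrK.
rewrite {2}E addrK.
under [RHS]eq_bigr => j _ do rewrite mulrBl mulrDl.
rewrite sumrB big_split /= opprB addrA; congr (_ - _).
  congr (_ + _).
    by rewrite big_ord_recl /= mul1r big1 ?addr0// => j _; rewrite mul0r.
  by rewrite big_ord_recr /= ltnn mul0r addr0; apply: eq_bigr => j _; rewrite ltn_ord.
by rewrite big_ord_recl /= mul0r add0r.
Qed.

End poly_extrapolation.

(** * Comparison of polynomial norms over boxes *)

Section polynomials.
Context {R : realType} {d : nat}.
Implicit Types (m : mpoly.mpoly d R) (x : euclid R d) (u v : 'I_d -> R).

Lemma measurable_peval m : measurable_fun setT (peval m : euclid R d -> R).
Proof.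
rewrite (_ : peval m = fun x : euclid R d =>
    \sum_(e <- mpoly.msupp m) (mpoly.mcoeff e m * \prod_(i <- enum 'I_d) tnth x i ^+ e i)).
  apply: measurable_sum => e; apply: measurable_funM => //.
  apply: measurable_prod => i _; apply: measurable_funX; exact: measurable_tnth.
by apply/funext => x; rewrite /peval mevalE; apply: eq_bigr => e _; rewrite big_enum.
Qed.

Lemma pevalD m1 m2 x : peval (m1 + m2) x = peval m1 x + peval m2 x.
Proof. exact: mevalD. Qed.

Lemma pevalB m1 m2 x : peval (m1 - m2) x = peval m1 x - peval m2 x.
Proof. exact: mevalB. Qed.

Lemma pevalZ (a : R) m x : peval (a *: m) x = a * peval m x.
Proof. exact: mevalZ. Qed.

Lemma peval0 x : peval (0 : mpoly.mpoly d R) x = 0.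
Proof. exact: meval0. Qed.

Lemma polysD l m1 m2 : polys l m1 -> polys l m2 -> polys l (m1 + m2).
Proof.
move=> H1 H2; rewrite /polys /=; apply: leq_trans (msizeD_le _ _) _.
by rewrite geq_max; apply/andP.
Qed.

Lemma polysZ l (a : R) m : polys l m -> polys l (a *: m).
Proof. by move=> H; rewrite /polys /=; apply: leq_trans (msizeZ_le _ _) _. Qed.

Lemma polysB l m1 m2 : polys l m1 -> polys l m2 -> polys l (m1 - m2).
Proof. by move=> H1 H2; rewrite -scaleN1r; apply: polysD => //; exact: polysZ. Qed.

Lemma polys0 l : polys l (0 : mpoly.mpoly d R).
Proof. by rewrite /polys /= mmeasure0. Qed.

Definition axis (i : 'I_d) (t : R) : euclid R d := [tuple (if j == i then t else 0 : R) | j < d].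

(** Restriction to a line reduces extrapolation to one variable; the degree bound holds monomial by
    monomial, each factor being affine in the parameter. *)
Lemma peval_line m x i (t : R) : exists p : {poly R}, (size p <= mpoly.msize m)%N /\
  forall a, p.[a] = peval m (translate (axis i (a * t)) x).
Proof.
pose p : {poly R} := \sum_(e <- mpoly.msupp m) (mpoly.mcoeff e m *:
  \prod_(j < d) ((tnth x j)%:P + (if j == i then t else 0)%:P * 'X) ^+ e j).
exists p; split.
  rewrite /p big_seq; apply: (big_ind (fun p : {poly R} => (size p <= mpoly.msize m)%N)).
  - by rewrite size_poly0.
  - by move=> p1 p2 H1 H2; apply: leq_trans (size_polyD _ _) _; rewrite geq_max H1.
  move=> e /msize_mdeg_lt; apply: leq_trans.
  apply: leq_trans (size_scale_leq _ _) _.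
  apply: leq_trans (size_poly_prod_leq _ _) _.
  rewrite leq_subLR mdegE addnS ltnS -sum1_card -big_split /=.
  apply: leq_sum => j _; apply: leq_trans (size_poly_exp_leq _ _) _.
  rewrite add1n ltnS -[leqRHS]mul1n leq_mul2r; apply/orP; right.
  rewrite -subn1 leq_subLR; apply: leq_trans (size_polyD _ _) _.
  rewrite geq_max; apply/andP; split.
    by rewrite size_polyC; case: (_ != 0).
  by rewrite mul_polyC; apply: leq_trans (size_scale_leq _ _) _; rewrite size_polyX.
move=> a; rewrite /p horner_sum /peval mevalE; apply: eq_bigr => e _.
rewrite hornerZ horner_prod; congr (_ * _); apply: eq_bigr => j _.
rewrite horner_exp !hornerE !tnth_mktuple; congr ((_ + _) ^+ _).
by case: eqP => _; rewrite ?mul0r// mulrC.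
Qed.

Lemma normLq_sum (q : \bar R) S (n : nat) (c : nat -> R) (F : nat -> euclid R d -> R) :
  (1 <= q)%E -> measurable S -> (forall j, measurable_fun setT (F j)) ->
  (normLq q S (fun x => \sum_(j < n) c j * F j x)%R <=
   \sum_(j < n) (`|c j|%:E * normLq q S (F j)))%E.
Proof.
move=> q1 mS mF; elim: n => [|n IH].
  rewrite big_ord0 (@normLq_congr _ _ _ _ _ (fun=> 0 * 0)).
    by rewrite (@normLqZ _ _ _ _ (fun=> 0))// normr0 mul0e.
  by move=> x _; rewrite big_ord0 mul0r.
rewrite big_ord_recr /=; apply: le_trans (_ : (normLq q S (fun x => \sum_(j < n) c j * F j x)%R
  + normLq q S (fun x => (c n * F n x)%R) <= _)%E); last first.
  by rewrite normLqZ// leeD2r.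
rewrite -(@normLq_congr _ _ _ _ (fun x => \sum_(j < n) c j * F j x + c n * F n x)); last first.
  by move=> x _; rewrite big_ord_recr.
apply: normLqD => //; last by apply: measurable_funM.
by apply: measurable_sum => j; exact: measurable_funM.
Qed.

(** The constant is the sum of the [|c j|] of the extrapolation formula. The sign of [t] is free, so
    that both sides of a box can be treated. *)
Lemma poly_shift_bound (k : nat) : (0 < k)%N -> exists C : R, 0 <= C /\
  forall (q : \bar R) m (i : 'I_d) (t : R) S S', (1 <= q)%E -> polys k.-1 m ->
  measurable S -> measurable S' ->
  (forall j x, (j < k)%N -> S x -> S' (translate (axis i (j.+1%:R * t)) x)) ->
  (normLq q S (peval m) <= C%:E * normLq q S' (peval m))%E.
Proof.
move=> k0; have [c Hc] := @poly_extrapolation R k.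
exists (\sum_(j < k) `|c j|); split; first by apply: sumr_ge0.
move=> q m i t S S' q1 mk mS mS' SS'.
have mp := measurable_peval m.
pose tau (j : nat) : euclid R d -> euclid R d := translate (axis i (j.+1%:R * t)).
have mtau j : measurable_fun setT (tau j) by exact: measurable_translate.
rewrite (@normLq_congr _ _ _ _ _ (fun x => \sum_(j < k) c j * (peval m \o tau j) x)); last first.
  move=> x _; have [p [sp Hp]] := peval_line m x i t.
  rewrite (_ : peval m x = p.[0]); last first.
    rewrite Hp; congr peval; apply: eq_from_tnth => j.
    by rewrite !tnth_mktuple mul0r if_same addr0.
  rewrite Hc; last by rewrite (leq_trans sp)// (leq_trans mk)// prednK.
  by apply: eq_bigr => j _; rewrite Hp.
apply: le_trans (@normLq_sum q S k c (fun j => peval m \o tau j) q1 mS _) _.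
  by move=> j; exact: measurableT_comp.
rewrite -sumEFin ge0_sume_distrl; last by move=> j _; rewrite lee_fin.
apply: lee_sum => j _; apply: lee_wpmul2l; first by rewrite lee_fin.
rewrite -(normLq_translate (axis i (j.+1%:R * t)) mS' mp q1).
apply: normLqS => //.
- by rewrite -[X in measurable X]setTI; exact: mtau.
- exact: measurableT_comp.
- by move=> x Sx; exact: SS'.
Qed.

Definition upd u (i : 'I_d) (a : R) : 'I_d -> R := fun j => if j == i then a else u j.

(** For a point of an added slab the [k] shifted points fall in the box because [k * t] is at most
    its side. The three summands of the constant stand for the box and the two slabs. *)
Lemma poly_slab_bound (k : nat) : (0 < k)%N -> exists C : R, 1 <= C /\
  forall (q : \bar R) m (i : 'I_d) (t : R) u v, (1 <= q)%E -> polys k.-1 m ->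
  0 <= t -> k%:R * t <= v i - u i ->
  (normLq q (box (upd u i (u i - t)) (upd v i (v i + t))) (peval m) <=
    C%:E * normLq q (box u v) (peval m))%E.
Proof.
move=> k0; have [C [C0 HC]] := poly_shift_bound k0.
exists (1 + C + C); split; first by lra.
move=> q m i t u v q1 mk t0 kt.
have mp := measurable_peval m.
pose lo := box (upd u i (u i - t)) (upd v i (u i)).
pose hi := box (upd u i (v i)) (upd v i (v i + t)).
apply: (@le_trans _ _ (normLq q (box u v `|` lo `|` hi) (peval m))).
  apply: normLqS => //; try exact: measurable_box.
    by do 2?apply: measurableU; exact: measurable_box.
  move=> x Hx; have [xu|ux] := ltP (tnth x i) (u i).
    left; right => j; have := Hx j; rewrite /upd; case: eqP => // ->.
    by move=> /andP[-> _].
  have [xv|vx] := ltP (tnth x i) (v i); last first.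
    right => j; have := Hx j; rewrite /upd; case: eqP => // ->.
    by move=> /andP[_ ->]; rewrite vx.
  by left; left => j; have := Hx j; rewrite /upd; case: eqP => // ->; rewrite ux.
apply: le_trans (normLqU _ _ mp q1) _; try exact: measurable_box.
  by apply: measurableU; exact: measurable_box.
rewrite !EFinD !ge0_muleDl ?adde_ge0 ?lee_fin// mul1e.
apply: leeD.
  apply: le_trans (normLqU _ _ mp q1) _; try exact: measurable_box.
  rewrite leeD2l//; apply: (HC q m i t) => //; try exact: measurable_box.
  move=> j x jk Hx l; have := Hx l; rewrite /translate /axis !tnth_mktuple /upd.
  case: eqP => [->|_]; last by rewrite addr0.
  have jk' : j.+1%:R * t <= k%:R * t by rewrite ler_wpM2r// ler_nat.
  have : t <= j.+1%:R * t by rewrite ler_peMl// ler1n.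
  by move=> *; lra.
apply: (HC q m i (- t)) => //; try exact: measurable_box.
move=> j x jk Hx l; have := Hx l; rewrite /translate /axis !tnth_mktuple /upd.
case: eqP => [->|_]; last by rewrite addr0.
have jk' : j.+1%:R * t <= k%:R * t by rewrite ler_wpM2r// ler_nat.
have : t <= j.+1%:R * t by rewrite ler_peMl// ler1n.
by rewrite mulrN; move=> *; lra.
Qed.

(** Each coordinate is widened by [M * l] on both sides in [k * M] slabs of width [l / k]; sides
    never shrink, so the slab bound stays applicable. Hence the exponents [k * M] and [d]. *)
Lemma poly_box_bound (k M : nat) : (0 < k)%N -> exists C : R, 1 <= C /\
  forall (q : \bar R) m (l : R) u v u' v', (1 <= q)%E -> polys k.-1 m ->
  0 < l -> (forall i, l <= v i - u i) ->
  (forall i, u i - M%:R * l <= u' i) -> (forall i, v' i <= v i + M%:R * l) ->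
  (normLq q (box u' v') (peval m) <= C%:E * normLq q (box u v) (peval m))%E.
Proof.
move=> k0; have [C [C1 HC]] := poly_slab_bound k0.
have C0 : 0 <= C by lra.
have grow_n n (q : \bar R) m i (t : R) u v : (1 <= q)%E -> polys k.-1 m ->
    0 <= t -> k%:R * t <= v i - u i ->
    (normLq q (box (upd u i (u i - n%:R * t)) (upd v i (v i + n%:R * t))) (peval m) <=
    (C ^+ n)%:E * normLq q (box u v) (peval m))%E.
  move=> q1 mk t0 kt; elim: n => [|n IH].
    rewrite expr0 mul1e; apply: normLqS => //; try exact: measurable_box.
      exact: measurable_peval.
    by apply: subset_box => j; rewrite /upd; case: eqP => // ->; rewrite mul0r ?subr0 ?addr0.
  rewrite exprS EFinM -muleA; apply: le_trans; last first.
    by apply: lee_wpmul2l IH; rewrite lee_fin.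
  apply: le_trans (HC q m i t _ _ q1 mk t0 _); last first.
    rewrite /upd eqxx; apply: le_trans kt _.
    by have : 0 <= n%:R * t by [rewrite mulr_ge0]; lra.
  apply: normLqS => //; try exact: measurable_box; first exact: measurable_peval.
  apply: subset_box => j; rewrite /upd eqxx; case: eqP => // _;
  by rewrite -natr1 mulrDl mul1r; lra.
exists ((C ^+ (k * M)) ^+ d); split; first by do 2!apply: exprn_ege1.
move=> q m l u v u' v' q1 mk l0 Hl Hu Hv.
pose D := M%:R * l.
have D0 : 0 <= D by rewrite mulr_ge0// ltW.
pose us (s : seq 'I_d) i := u i - (i \in s)%:R * D.
pose vs (s : seq 'I_d) i := v i + (i \in s)%:R * D.
have key s : (normLq q (box (us s) (vs s)) (peval m) <=
    ((C ^+ (k * M)) ^+ size s)%:E * normLq q (box u v) (peval m))%E.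
  elim: s => [|i s IH].
    rewrite expr0 mul1e; apply: normLqS => //; try exact: measurable_box.
      exact: measurable_peval.
    by apply: subset_box => j; rewrite /us /vs mul0r ?subr0 ?addr0.
  rewrite /= exprS EFinM -muleA; apply: le_trans; last first.
    by apply: lee_wpmul2l IH; rewrite lee_fin exprn_ge0.
  have k0' : (0 : R) < k%:R by rewrite ltr0n.
  apply: le_trans (grow_n (k * M)%N q m i (l / k%:R) _ _ q1 mk _ _); last 2 first.
  - by rewrite divr_ge0// ltW.
  - rewrite mulrC divfK ?gt_eqF//; apply: le_trans (Hl i) _.
    rewrite /us /vs; have : 0 <= (i \in s)%:R * D by rewrite mulr_ge0.
    by lra.
  apply: normLqS => //; try exact: measurable_box; first exact: measurable_peval.
  have E : (k * M)%:R * (l / k%:R) = D.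
    by rewrite natrM /D; field; rewrite gt_eqF.
  rewrite E.
  apply: subset_box => j; rewrite /upd /us /vs inE; case: eqP => [->|_] //=;
  by have : 0 <= (i \in s)%:R * D by [rewrite mulr_ge0]; lra.
have := key (enum 'I_d); rewrite size_enum_ord; apply: le_trans.
apply: normLqS => //; try exact: measurable_box; first exact: measurable_peval.
by apply: subset_box => j; rewrite /us /vs mem_enum inE mul1r.
Qed.

End polynomials.

(** * Closedness of spaces of polynomials *)

Section closed_span.
Context {R : realType} {d : nat}.
Implicit Types (m : mpoly.mpoly d R) (x : euclid R d) (f : euclid R d -> R).

(** A recursion on the list of generators, so that closedness can be proved by removing one
    generator at a time. *)
Fixpoint in_span (B : seq (mpoly.mpoly d R)) m : Prop :=
  if B is b :: B' then exists a m', in_span B' m' /\ m = a *: b + m' else m = 0.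

Lemma in_span0 B : in_span B 0.
Proof. by elim: B => [//|b B IH]; exists 0, 0; rewrite scale0r addr0. Qed.

Lemma in_spanD B m1 m2 : in_span B m1 -> in_span B m2 -> in_span B (m1 + m2).
Proof.
elim: B m1 m2 => [|b B IH] m1 m2 /=; first by move=> -> ->; rewrite addr0.
move=> [a1 [n1 [s1 ->]]] [a2 [n2 [s2 ->]]]; exists (a1 + a2), (n1 + n2).
by split; [exact: IH|rewrite scalerDl addrACA].
Qed.

Lemma in_spanZ B a m : in_span B m -> in_span B (a *: m).
Proof.
elim: B m => [|b B IH] m /=; first by move=> ->; rewrite scaler0.
move=> [a1 [n1 [s1 ->]]]; exists (a * a1), (a *: n1).
by split; [exact: IH|rewrite scalerDr scalerA].
Qed.

Lemma in_span_sum (I : Type) (s : seq I) (c : I -> R) (b : I -> mpoly.mpoly d R) :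
  in_span (map b s) (\sum_(i <- s) c i *: b i).
Proof.
elim: s => [|i s IH] /=; first by rewrite big_nil.
by rewrite big_cons; exists (c i), (\sum_(j <- s) c j *: b j).
Qed.

Lemma in_span_polys l B m : (forall b, b \in B -> polys l b) -> in_span B m -> polys l m.
Proof.
elim: B m => [|b B IH] m HB /=; first by move=> ->; exact: polys0.
move=> [a [m' [sm' ->]]]; apply: polysD.
  by apply/polysZ/HB; rewrite mem_head.
by apply: IH sm' => b' b'B; apply: HB; rewrite inE b'B orbT.
Qed.

Lemma polys_span l : exists B : seq (mpoly.mpoly d R), forall m, polys l m <-> in_span B m.
Proof.
exists [seq mpoly.mpolyX R (mpoly.bmnm e) | e <- enum {: mpoly.bmultinom d l.+1}] => m; split.
  move=> /mpolywE ->; rewrite -big_enum; exact: in_span_sum.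
apply: in_span_polys => _ /mapP[e _ ->]; rewrite /polys /= msizeX; exact: bmdeg.
Qed.

Variables (q : \bar R) (S : set (euclid R d)).
Hypotheses (q1 : (1 <= q)%E) (mS : measurable S).
Local Notation N := (normLq q S).

(* Induction on the spanning list: a vector at positive distance from the span
   of the others has a convergent coefficient along any minimizing sequence. *)
Lemma span_closed B f : (forall m, in_span B m -> (N (peval m) < +oo)%E) ->
  measurable_fun setT f ->
  (forall e, 0 < e -> exists2 m, in_span B m & (N (fun x => f x - peval m x)%R <= e%:E)%E) ->
  exists2 m, in_span B m & (N (fun x => f x - peval m x)%R <= 0)%E.
Proof.
elim: B f => [|b B IH] f Hfin mf Hf.
  exists 0 => //; apply/lee_addgt0Pr => e e0; rewrite add0e.
  by have [m /= ->] := Hf _ e0.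
have sub m : in_span B m -> in_span (b :: B) m.
  by move=> sm; exists 0, m; rewrite scale0r add0r.
have HfinB m : in_span B m -> (N (peval m) < +oo)%E by move=> /sub; exact: Hfin.
have mp m := measurable_peval m.
(* If [b] is in the closure of the span of [B], it differs from some [m0] of that span by a function
   of norm 0, and [m0] replaces it. *)
have [Hb|] := pselect (forall e, 0 < e ->
    exists2 m, in_span B m & (N (fun x => peval b x - peval m x)%R <= e%:E)%E).
  have [m0 sm0 Nm0] := IH _ HfinB (mp b) Hb.
  have [|m sm Nm] := IH f HfinB mf; last by exists m => //; exact: sub.
  move=> e /Hf[_ [a [m [sm ->]]] Nm].
  exists (m + a *: m0); first by apply: in_spanD => //; exact: in_spanZ.
  rewrite -(@normLq_congr _ _ _ _ (fun x =>
    (f x - peval (a *: b + m) x) + a * (peval b x - peval m0 x))); last first.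
    by move=> x _; rewrite !pevalD !pevalZ; ring.
  apply: le_trans (normLqD mS _ _ q1) _.
  - exact: measurable_funB.
  - by apply: measurable_funM => //; exact: measurable_funB.
  rewrite normLqZ//; last exact: measurable_funB.
  apply: le_trans (leeD Nm (lee_wpmul2l _ Nm0)) _; first by rewrite lee_fin.
  by rewrite mule0 adde0.
move=> /existsNP[dl /not_implyP[dl0 Hdl]].
have dist m : in_span B m -> (dl%:E <= N (fun x => peval b x + peval m x)%R)%E.
  move=> sm; rewrite leNgt; apply/negP => lt; apply: Hdl; exists (- m).
    by rewrite -scaleN1r; exact: in_spanZ.
  rewrite (@normLq_congr _ _ _ _ _ (fun x => peval b x + peval m x)) ?ltW// => x _.
  by rewrite -[in peval (- m)]scaleN1r pevalZ mulN1r opprK.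
have /choice[am Ham] : forall n : nat, exists am : R * mpoly.mpoly d R,
    in_span B am.2 /\ (N (fun x => f x - peval (am.1 *: b + am.2) x)%R <= (n.+1%:R^-1)%:E)%E.
  move=> n; have [|_ [a [m [sm ->]]] Nm] := Hf n.+1%:R^-1; first by rewrite invr_gt0.
  by exists (a, m).
pose a n := (am n).1; pose m n := (am n).2.
(* For [a n != a l], two approximants differ by [a n - a l] times the sum of [b] and an element of
   the span of [B], so by at least [|a n - a l| * dl] in norm; both are close to [f]. *)
have aC n l : `|a n - a l| * dl <= n.+1%:R^-1 + l.+1%:R^-1.
  have [->|anl] := eqVneq (a n) (a l).
    by rewrite subrr normr0 mul0r addr_ge0// invr_ge0.
  have Nb : (`|a n - a l|%:E * dl%:E <=
      N (fun x => (a n - a l) * peval b x + (peval (m n) x - peval (m l) x))%R)%E.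
    have -> : N (fun x => (a n - a l) * peval b x + (peval (m n) x - peval (m l) x))%R =
       (`|a n - a l|%:E * N (fun x => peval b x + peval ((a n - a l)^-1 *: (m n - m l)) x)%R)%E.
      rewrite -normLqZ//; last exact: measurable_funD.
      apply: normLq_congr => x _; rewrite pevalZ pevalB mulrDr mulrA mulfV ?mul1r//.
      by rewrite subr_eq0.
    apply: lee_wpmul2l; first by rewrite lee_fin.
    apply: dist; apply: in_spanZ; apply: in_spanD; first exact: (Ham n).1.
    by rewrite -scaleN1r; apply: in_spanZ; exact: (Ham l).1.
  rewrite -lee_fin EFinM EFinD; apply: le_trans Nb _.
  rewrite (@normLq_congr _ _ _ _ _ (fun x =>
    (f x - peval (a l *: b + m l) x) + - (f x - peval (a n *: b + m n) x))); last first.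
    by move=> x _; rewrite !pevalD !pevalZ; ring.
  apply: le_trans (normLqD mS _ _ q1) _.
  - exact: measurable_funB.
  - by apply: measurable_funN; exact: measurable_funB.
  by rewrite normLqN [leRHS]addeC; apply: leeD; [exact: (Ham l).2|exact: (Ham n).2].
(* The intervals of radius [n.+1%:R^-1 / dl] around the [a n] meet pairwise; the supremum of their
   left ends lies in all of them and is the limit of the coefficients. *)
pose X := [set a n - n.+1%:R^-1 / dl | n in [set: nat]].
have ubX l : ubound X (a l + l.+1%:R^-1 / dl).
  move=> _ [n _ <-]; rewrite lerBlDr -addrA -lerBlDl -mulrDl ler_pdivlMr//.
  rewrite [leRHS]addrC; apply: le_trans (aC n l).
  by rewrite ler_wpM2r ?ler_norm ?ltW.
have supX : has_sup X.
  split; first by exists (a 0%N - 1%:R^-1 / dl), 0%N.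
  by exists (a 0%N + 1%:R^-1 / dl); exact: ubX.
pose t := sup X.
have at_ n : `|a n - t| <= n.+1%:R^-1 / dl.
  rewrite ler_norml; apply/andP; split.
    rewrite lerNl opprB lerBlDl; apply: ge_sup; first exact: supX.1.
    exact: ubX.
  rewrite lerBlDr -lerBlDl; apply: ub_le_sup; first exact: supX.2.
  by exists n.
have sb : in_span (b :: B) b.
  by exists 1, 0; split; [exact: in_span0|rewrite scale1r addr0].
have Nbfin : N (peval b) \is a fin_num.
  by rewrite ge0_fin_numE ?normLq_ge0//; exact: Hfin.
have Nb0 : 0 <= fine (N (peval b)) by apply/fine_ge0/normLq_ge0.
have [||m' sm' Nm'] := IH (fun x => f x - t * peval b x) HfinB.
- by apply: measurable_funB => //; exact: measurable_funM.
- move=> e e0; pose K := 1 + fine (N (peval b)) / dl.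
  have K0 : 0 < K by rewrite ltr_pwDl// divr_ge0// ltW.
  pose n := Num.truncn (K / e).
  have Kn : n.+1%:R^-1 * K <= e.
    rewrite mulrC ler_pdivrMr// mulrC -ler_pdivrMr//.
    exact/ltW/truncnS_gt.
  exists (m n); first exact: (Ham n).1.
  rewrite (@normLq_congr _ _ _ _ _ (fun x =>
    (f x - peval (a n *: b + m n) x) + (a n - t) * peval b x)); last first.
    by move=> x _; rewrite pevalD pevalZ; ring.
  apply: le_trans (normLqD mS _ _ q1) _.
  - exact: measurable_funB.
  - exact: measurable_funM.
  have h : (`|a n - t|%:E <= (n.+1%:R^-1 / dl)%:E)%E by rewrite lee_fin.
  rewrite normLqZ//.
  apply: le_trans (leeD (Ham n).2 (lee_wpmul2r (normLq_ge0 _ _ _) h)) _.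
  rewrite -(fineK Nbfin) -EFinM -EFinD lee_fin.
  apply: le_trans Kn; rewrite /K mulrDr mulr1 lerD2l.
  by rewrite le_eqVlt; apply/orP; left; apply/eqP; ring.
exists (t *: b + m'); first by exists t, m'.
apply: le_trans Nm'; rewrite le_eqVlt; apply/orP; left; apply/eqP.
by apply: normLq_congr => x _; rewrite pevalD pevalZ; ring.
Qed.

End closed_span.

(** * Gluing approximations *)

Section approximable.
Context {R : realType} {d : nat}.
Implicit Types (m : mpoly.mpoly d R) (x : euclid R d) (f : euclid R d -> R)
  (S : set (euclid R d)) (q : \bar R) (k : nat) (u v : 'I_d -> R).
Local Notation mu := (lebesgue_euclid R d).

Lemma unit_cube_box : unit_cube = box (fun=> 0) (fun=> 1) :> set (euclid R d).
Proof.
by apply/seteqP; split => x Hx i; have := Hx i; rewrite ?tnth_mktuple ?add0r.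
Qed.

Lemma measurable_unit_cube : measurable (unit_cube : set (euclid R d)).
Proof. by rewrite unit_cube_box; exact: measurable_box. Qed.

Lemma normLq_unit_cube_cst q (M : R) : (1 <= q)%E ->
  (normLq q unit_cube ((fun=> M) : euclid R d -> R) <= `|M|%:E)%E.
Proof.
move=> q1; have mU : measurable (unit_cube : set (euclid R d)) := measurable_unit_cube.
case: q q1 => [r||//]; last first.
  move=> _; apply/normLq_infty_le => //; right; apply: nearW => x.
  by rewrite normrM ler_piMr// indicE; case: (_ \in _); rewrite ?normr1 ?normr0.
rewrite lee_fin => r1; have r0 : 0 < r by exact: lt_le_trans r1.
rewrite (@normLq_congr R d _ _ _ (fun=> M * 1)); last by move=> x _; rewrite mulr1.
rewrite normLqZ// -[leRHS]mule1; apply: lee_wpmul2l; first by rewrite lee_fin.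
rewrite -(poweRe1 (normLq_ge0 _ _ _)) -[X in (_ `^ X)%E](mulfV (lt0r_neq0 r0)).
rewrite poweRrM poweR_normLq// (_ : (\int[mu]_x _)%E = 1%E); first by rewrite poweR1r.
transitivity (\int[mu]_x (\1_unit_cube x)%:E)%E.
  apply: eq_integral => x _; rewrite mul1r indicE.
  by case: (_ \in _); rewrite ?normr1 ?normr0 ?powR1 ?powR0 ?gt_eqF.
rewrite integral_indic// setIT.
by have := @lebesgue_cube R d [tuple 0 | i < d] 1 ltr01; rewrite expr1n.
Qed.

Lemma normLq_peval_lty q S m : (1 <= q)%E -> measurable S -> S `<=` unit_cube ->
  (normLq q S (peval m) < +oo)%E.
Proof.
move=> q1 mS SU.
pose C := \sum_(e <- mpoly.msupp m) `|mpoly.mcoeff e m|.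
apply: (@le_lt_trans _ _ (normLq q (unit_cube : set (euclid R d)) (fun=> C))); last first.
  by apply: le_lt_trans (normLq_unit_cube_cst _ q1) _; rewrite ltry.
apply: le_normLq => //; first exact: measurable_unit_cube.
  exact: measurable_peval.
move=> x; rewrite !normrM !indicE.
have [Sx|Sx] := pselect (S x); last by rewrite (memNset Sx) normr0 mulr0 mulr_ge0.
rewrite !mem_set//; last exact: SU.
rewrite ler_wpM2r// /peval mevalE [leRHS]ger0_norm ?sumr_ge0//.
apply: le_trans (ler_norm_sum _ _ _) _; apply: ler_sum => e _.
rewrite normrM ler_piMr// normr_prod.
have Ux := SU _ Sx.
apply: prodr_ile1 => i _; rewrite normr_ge0 /= normrX.
have := Ux i; rewrite tnth_mktuple add0r => /andP[x0 x1].
by rewrite exprn_ile1// ger0_norm// ltW.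
Qed.

(** Asks for a polynomial realizing the bound rather than for an infimum, so that gluing works with
    actual polynomials. *)
Definition poly_approx k q f S (eta : R) : Prop := exists m, polys k.-1 m /\
  (normLq q S (fun x => f x - peval m x)%R <= eta%:E)%E.

(** For [eta > 0] the factor 2 leaves room above the infimum. For [eta = 0] there is none, and
    attainment comes from the closedness of the span of the monomials. *)
Lemma best_approx_approx k q f S (eta : R) : (1 <= q)%E -> measurable S ->
  S `<=` unit_cube -> measurable_fun setT f -> 0 <= eta ->
  (best_approx k f S q <= eta%:E)%E -> poly_approx k q f S (2 * eta).
Proof.
move=> q1 mS SU mf eta0 H.
have near e : eta < e -> exists m, polys k.-1 m /\ (normLq q S (fun x => f x - peval m x)%R <= e%:E)%E.
  move=> ee; have : (best_approx k f S q < e%:E)%E by apply: le_lt_trans H _; rewrite lte_fin.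
  by move=> /ereal_inf_lt[_ [m Pm <-] /ltW]; exists m.
have [eta_gt0|] := ltP 0 eta.
  by apply: near; rewrite ltr_pMl// ltr1n.
move=> eta_le0; have eta_eq0 : eta = 0 by apply/eqP; rewrite eq_le eta_le0.
have [B HB] := @polys_span R d k.-1.
have [m _||m sm Nm] := @span_closed _ _ _ _ q1 mS B f _ mf.
- exact: normLq_peval_lty.
- by move=> e; rewrite -{1}eta_eq0 => /near[m [/HB sm Nm]]; exists m.
by exists m; split; [exact/HB|rewrite eta_eq0 mulr0].
Qed.

Lemma poly_approx_le k q f S (eta eta' : R) : eta <= eta' ->
  poly_approx k q f S eta -> poly_approx k q f S eta'.
Proof.
by move=> ee [m [Pm Nm]]; exists m; split => //; apply: le_trans Nm _; rewrite lee_fin.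
Qed.

(** The two polynomials differ by at most [2 * eta] on the common box, hence by at most
    [2 * C * eta] on the larger box containing [S2]. The first one thus serves on the union, with
    error [eta] on [S1] and [eta + 2 * C * eta] on [S2]. *)
Lemma approx_glue k (M : nat) : (0 < k)%N -> exists C : R, 1 <= C /\
  forall q f S1 S2 (l : R) u v u' v' (eta : R), (1 <= q)%E -> measurable_fun setT f ->
  measurable S1 -> measurable S2 -> 0 < l -> 0 <= eta ->
  (forall i, l <= v i - u i) ->
  (forall i, u i - M%:R * l <= u' i) -> (forall i, v' i <= v i + M%:R * l) ->
  box u v `<=` S1 -> box u v `<=` S2 -> S2 `<=` box u' v' ->
  poly_approx k q f S1 eta -> poly_approx k q f S2 eta -> poly_approx k q f (S1 `|` S2) (C * eta).
Proof.
move=> k0; have [C [C1 HC]] := @poly_box_bound R d k M k0.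
exists (2 + 2 * C); split; first by lra.
move=> q f S1 S2 l u v u' v' eta q1 mf mS1 mS2 l0 eta0 Hl Hu Hv b1 b2 b' [m1 [P1 N1]] [m2 [P2 N2]].
exists m1; split => //.
have mfp m : measurable_fun setT (fun x => f x - peval m x).
  by apply: measurable_funB => //; exact: measurable_peval.
apply: le_trans (normLqU mS1 mS2 (mfp m1) q1) _.
have Nb : (normLq q (box u v) (peval (m2 - m1)%R) <= eta%:E + eta%:E)%E.
  rewrite (@normLq_congr _ _ _ _ _ (fun x => (f x - peval m1 x) + - (f x - peval m2 x))); last first.
    by move=> x _; rewrite pevalB; ring.
  apply: le_trans (normLqD (measurable_box _ _) (mfp m1) (measurable_funN (mfp m2)) q1) _.
  rewrite normLqN; apply: leeD.
    by apply: le_trans N1; apply: normLqS => //; exact: measurable_box.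
  by apply: le_trans N2; apply: normLqS => //; exact: measurable_box.
have N21 : (normLq q S2 (peval (m2 - m1)%R) <= (C * (eta + eta))%:E)%E.
  apply: (@le_trans _ _ (normLq q (box u' v') (peval (m2 - m1)%R))).
    by apply: normLqS => //; [exact: measurable_box|exact: measurable_peval].
  apply: le_trans (HC q _ l u v u' v' q1 (polysB P2 P1) l0 Hl Hu Hv) _.
  by rewrite EFinM EFinD; apply: lee_wpmul2l => //; rewrite lee_fin; lra.
have N3 : (normLq q S2 (fun x => f x - peval m1 x)%R <= eta%:E + (C * (eta + eta))%:E)%E.
  rewrite (@normLq_congr _ _ _ _ _ (fun x => (f x - peval m2 x) + peval (m2 - m1)%R x)); last first.
    by move=> x _; rewrite pevalB; ring.
  apply: le_trans (normLqD mS2 (mfp m2) (measurable_peval _) q1) _.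
  exact: leeD.
apply: le_trans (leeD N1 N3) _.
by rewrite -!EFinD lee_fin le_eqVlt; apply/orP; left; apply/eqP; ring.
Qed.

Definition cubes_approx k q f S (eta : R) : Prop := forall (a : euclid R d) (r : R),
  0 < r -> cube a r `<=` S -> poly_approx k q f (cube a r) eta.

Lemma cubes_approxS k q f S S' (eta : R) : S `<=` S' -> cubes_approx k q f S' eta ->
  cubes_approx k q f S eta.
Proof. by move=> SS H a r r0 aS; apply: H => //; exact: subset_trans SS. Qed.

End approximable.

Section box_approx.
Context {R : realType} {d : nat}.
Implicit Types (x : euclid R d) (f : euclid R d -> R)
  (S : set (euclid R d)) (q : \bar R) (k : nat) (u v : 'I_d -> R).

(** A cube of side [l] is lengthened in one direction at a time, by gluing pieces that overlap in at
    least [l / 2]. The induction runs over the list of directions whose side may differ from [l]. *)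
Lemma approx_box k (M : nat) : (0 < k)%N -> exists C : R, 1 <= C /\
  forall q f (l : R) u v (eta : R), (1 <= q)%E -> measurable_fun setT f ->
  0 < l -> 0 <= eta -> (forall i, l <= v i - u i <= M%:R * l) ->
  cubes_approx k q f (box u v) eta -> poly_approx k q f (box u v) (C * eta).
Proof.
move=> k0; have [Cg [Cg1 HCg]] := @approx_glue R d k 2 k0.
have key (s : seq 'I_d) : exists C : R, 1 <= C /\
    forall q f (l : R) u v (eta : R), (1 <= q)%E -> measurable_fun setT f ->
    0 < l -> 0 <= eta -> (forall i, i \in s -> l <= v i - u i <= M%:R * l) ->
    (forall i, i \notin s -> v i - u i = l) ->
    cubes_approx k q f (box u v) eta -> poly_approx k q f (box u v) (C * eta).
  elim: s => [|i s [C [C1 IH]]].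
    exists 1; split => // q f l u v eta q1 mf l0 eta0 _ Hl H.
    have E := @box_cube R d u v l (fun i => Hl i isT).
    by rewrite mul1r E; apply: H => //; rewrite E.
  have [si|si] := boolP (i \in s).
    exists C; split => // q f l u v eta q1 mf l0 eta0 H1 H2.
    apply: (IH q f l) => //.
      by move=> j js; apply: H1; rewrite inE js orbT.
    move=> j js; apply: H2; rewrite inE negb_or js andbT.
    by apply: contraNneq js => ->.
  (* [n] counts half-steps in direction [i]; [2 * M] of them cover all sides up to [M * l]. *)
  have step n : exists Cn : R, 1 <= Cn /\
      forall q f (l : R) u v (eta : R), (1 <= q)%E -> measurable_fun setT f ->
      0 < l -> 0 <= eta -> (forall j, j \in s -> l <= v j - u j <= M%:R * l) ->
      (forall j, j \notin i :: s -> v j - u j = l) ->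
      l <= v i - u i <= l * (1 + n%:R / 2) ->
      cubes_approx k q f (box u v) eta -> poly_approx k q f (box u v) (Cn * eta).
    elim: n => [|n [Cn [Cn1 IHn]]].
      exists C; split => // q f l u v eta q1 mf l0 eta0 H1 H2 H3.
      apply: (IH q f l) => // j js; have [ji|ji] := eqVneq j i.
        by subst j; move: H3; rewrite mul0r addr0 mulr1 => /andP[? ?]; apply/eqP; rewrite eq_le; apply/andP.
      by apply: H2; rewrite inE negb_or ji.
    exists (Cn + Cg * (Cn + C)); split.
      suff : 0 <= Cg * (Cn + C) by lra.
      by apply: mulr_ge0; lra.
    move=> q f l u v eta q1 mf l0 eta0 H1 H2 /andP[H3 H4] H.
    have le1 (z : R) : z <= Cn + Cg * (Cn + C) -> z * eta <= (Cn + Cg * (Cn + C)) * eta.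
      by move=> zz; rewrite ler_wpM2r.
    have [H5|H5] := leP (v i - u i) (l * (1 + n%:R / 2)).
      apply: (@poly_approx_le _ _ _ _ _ _ (Cn * eta)).
        apply: le1; suff : 0 <= Cg * (Cn + C) by lra.
        by apply: mulr_ge0; lra.
      by apply: (IHn q f l) => //; rewrite H3.
    have n0 : 0 <= l * n%:R by rewrite mulr_ge0// ltW.
    have nE : l * (1 + n.+1%:R / 2) = l + l * n%:R / 2 + l / 2 by rewrite -natr1; field.
    have nE' : l * (1 + n%:R / 2) = l + l * n%:R / 2 by field.
    (* The lower piece reaches [w] and the upper one has length [l]; as the side is at most
       [l * (1 + (n + 1) / 2)], they overlap in at least [l / 2]. *)
    pose w := u i + l * (1 + n%:R / 2).
    rewrite nE in H4; rewrite nE' in H5.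
    have G1s : box u (upd v i w) `<=` box u v.
      by apply: subset_box => // j; rewrite /upd /w nE'; case: eqP => // ->; lra.
    have G2s : box (upd u i (v i - l)) v `<=` box u v.
      by apply: subset_box => // j; rewrite /upd; case: eqP => // ->; lra.
    have G1 : poly_approx k q f (box u (upd v i w)) (Cn * eta).
      apply: (IHn q f l) => //; last exact: cubes_approxS H.
      - by move=> j js; rewrite /upd (_ : j == i = false) ?H1//; apply: contraNF si => /eqP <-.
      - by move=> j; rewrite inE negb_or /upd => /andP[/negPf ji js]; rewrite ji; apply: H2; rewrite inE ji.
      - by rewrite /upd eqxx /w nE'; apply/andP; split; lra.
    have G2 : poly_approx k q f (box (upd u i (v i - l)) v) (C * eta).
      apply: (IH q f l) => //; last exact: cubes_approxS H.
      - by move=> j js; rewrite /upd (_ : j == i = false) ?H1//; apply: contraNF si => /eqP <-.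
      - move=> j js; rewrite /upd; case: eqP => [->|/eqP ji]; first by rewrite opprB addrC subrK.
        by apply: H2; rewrite inE negb_or ji.
    have -> : box u v = box u (upd v i w) `|` box (upd u i (v i - l)) v.
      apply/seteqP; split => x; last by case; [exact: G1s|exact: G2s].
      move=> Hx; have [xw|wx] := ltP (tnth x i) w.
        by left => j; have := Hx j; rewrite /upd; case: eqP => // ->; rewrite xw => /andP[->].
      right => j; have := Hx j; rewrite /upd; case: eqP => // -> /andP[_ ->]; rewrite andbT.
      by apply: le_trans wx; rewrite /w nE'; lra.
    apply: (@poly_approx_le _ _ _ _ _ _ (Cg * ((Cn + C) * eta))).
      by rewrite mulrA; apply: le1; lra.
    have Ml j : j \in s -> l <= v j - u j by move=> /H1/andP[].
    apply: (HCg q f _ _ (l / 2) (upd u i (v i - l)) (upd v i w) (upd u i (v i - l)) v) => //.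
    - exact: measurable_box.
    - exact: measurable_box.
    - by rewrite divr_gt0.
    - by rewrite mulr_ge0// addr_ge0; lra.
    - move=> j; rewrite /upd; case: eqP => [_|/eqP ji]; first by rewrite /w nE'; lra.
      have [js|js] := boolP (j \in s); first by have := Ml _ js; lra.
      have := H2 j; rewrite inE negb_or ji js => /(_ isT); lra.
    - by move=> j; lra.
    - by move=> j; rewrite /upd; case: eqP => [->|_]; rewrite ?/w ?nE'; lra.
    - by apply: subset_box => // j; rewrite /upd; case: eqP => // ->; lra.
    - by apply: subset_box => // j; rewrite /upd; case: eqP => // ->; rewrite /w nE'; lra.
    - by apply: poly_approx_le G1; rewrite ler_wpM2r//; lra.
    - by apply: poly_approx_le G2; rewrite ler_wpM2r//; lra.
  have [Cn [Cn1 HCn]] := step (2 * M)%N.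
  exists Cn; split => // q f l u v eta q1 mf l0 eta0 H1 H2 H.
  apply: (HCn q f l) => //.
    by move=> j js; apply: H1; rewrite inE js orbT.
  have /andP[-> h] := H1 i (mem_head _ _); apply: le_trans h _.
  by rewrite natrM [leLHS]mulrC mulrDr mulr1 (mulrC 2) mulfK// lerDr ltW.
have [C [C1 HC]] := key (enum 'I_d).
exists C; split => // q f l u v eta q1 mf l0 eta0 Hl H.
apply: (HC q f l) => // i; by rewrite mem_enum.
Qed.

End box_approx.

(** * Approximation on rings *)

Section ring_approx.
Context {R : realType} {d : nat}.
Implicit Types (x : euclid R d) (f : euclid R d -> R) (S : set (euclid R d)) (q : \bar R).

Section slabs.
(** [Q'] has corner [A] and side [L], [Q''] has corner [a] and side [l]. Of the dyadic position, the
    alternatives retain that corresponding faces coincide or lie at least [l] apart. *)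
Variables (A a : 'I_d -> R) (L l : R).
Hypotheses (l0 : 0 < l) (lL : 2 * l <= L)
  (Aa : forall i, a i = A i \/ A i + l <= a i)
  (aA : forall i, a i + l = A i + L \/ a i + l + l <= A i + L).
Implicit Type p : 'I_d * bool.

Let Q' : set (euclid R d) := box A (fun i => A i + L).
Let Q'' : set (euclid R d) := box a (fun i => a i + l).

(* The slab p = (i, t) is the part of Q' lying on one side of Q'' in direction i, cut
   down to the points within twice its thickness of Q''.  Its sides are comparable
   because a nonzero thickness is at least l; a thickness 0 gives an empty slab. *)
Let thickness p := if p.2 then A p.1 + L - (a p.1 + l) else a p.1 - A p.1.
Let lo p j := if j == p.1 then (if p.2 then a j + l else A j)
  else Num.max (A j) (a j - 2 * thickness p).
Let hi p j := if j == p.1 then (if p.2 then A j + L else a j)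
  else Num.min (A j + L) (a j + l + 2 * thickness p).
Let slab p : set (euclid R d) := box (lo p) (hi p).

Let Aa_le i : A i <= a i. Proof. by case: (Aa i) => [->//|]; move: l0; lra. Qed.
Let aA_le i : a i + l <= A i + L. Proof. by case: (aA i) => [->//|]; move: l0; lra. Qed.

Ltac slra := have := l0; have := lL; lra.

Let thickness_or p : thickness p = 0 \/ l <= thickness p.
Proof.
rewrite /thickness; case: p => i [] /=.
  by case: (aA i) => h; [left|right]; slra.
by case: (Aa i) => h; [left|right]; slra.
Qed.

Let thickness_le p : thickness p <= L.
Proof.
by rewrite /thickness; case: p => i [] /=; have := Aa_le i; have := aA_le i; slra.
Qed.

(** The two gaps in direction [i] add up to [L - l >= L / 2]. *)
Let far i : exists t, L / 4 <= thickness (i, t).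
Proof.
have [h|h] := leP (L / 4) (a i - A i); first by exists false.
by exists true; rewrite /thickness /=; slra.
Qed.

Let le_minB (c x y z : R) : c <= x - z -> c <= y - z -> c <= Num.min x y - z.
Proof. by rewrite /Order.min; case: ifP. Qed.

Let le_Bmax (c x y z : R) : c <= x - y -> c <= x - z -> c <= x - Num.max y z.
Proof. by rewrite /Order.max; case: ifP. Qed.

Let side_ge p j : l <= thickness p -> thickness p <= hi p j - lo p j.
Proof.
move=> lp; have := Aa_le j; have := aA_le j; have := thickness_le p.
rewrite /hi /lo; case: eqP => [->|_] *; last first.
  by apply: le_minB; apply: le_Bmax; slra.
by rewrite {1}/thickness; case: (p.2); slra.
Qed.

(** In directions other than [p.1] the side is at most [l + 4 * thickness p], and
    [l <= thickness p]; this is the origin of the ratio 5. *)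
Let side_le p j : l <= thickness p -> hi p j - lo p j <= 5 * thickness p.
Proof.
move=> lp; rewrite /hi /lo; case: eqP => [->|_].
  by move: lp; rewrite /thickness; case: (p.2); slra.
have h1 : Num.min (A j + L) (a j + l + 2 * thickness p) <= a j + l + 2 * thickness p.
  by rewrite ge_min lexx orbT.
have h2 : a j - 2 * thickness p <= Num.max (A j) (a j - 2 * thickness p).
  by rewrite le_max lexx orbT.
by slra.
Qed.

(** In direction [p'.1], [p] reaches [2 * thickness p] past [Q''], unless cut off by [Q'], and [p']
    has length at least [L / 4]. In direction [p.1] the roles are exchanged, and in the others both
    cover the projection of [Q'']. The factor 1/4 compares [thickness p <= L] with [L / 4]. *)
Let overlap p p' j : p.1 != p'.1 -> l <= thickness p -> L / 4 <= thickness p' ->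
  thickness p / 4 <= Num.min (hi p j) (hi p' j) - Num.max (lo p j) (lo p' j).
Proof.
move=> pp lp lp'; have tL := thickness_le p; have tL' := thickness_le p'.
have tp0 : 0 < thickness p by slra.
have lt' : l / 2 <= thickness p' by slra.
have Aj := Aa_le j; have aj := aA_le j.
have h1 := side_ge j lp.
have h2 : thickness p / 4 <= hi p' j - lo p' j.
  rewrite /hi /lo; case: eqP => [->|_]; last by apply: le_minB; apply: le_Bmax; slra.
  have : thickness p / 4 <= thickness p' by slra.
  by rewrite {2}/thickness; case: (p'.2); slra.
apply: le_minB; apply: le_Bmax => //; try slra; rewrite /hi /lo.
  case: eqP => [jp|_]; case: eqP => [jp'|_].
  - by move: pp; rewrite -jp -jp' eqxx.
  - move: h1; rewrite /hi /lo jp eqxx; case: (p.2) => h1; rewrite -?jp in h1 *; apply: le_Bmax; slra.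
  - move: lp'; rewrite {1}/thickness -jp'; case: (p'.2) => lp'; apply: le_minB; slra.
  - by apply: le_minB; apply: le_Bmax; slra.
case: eqP => [jp|_]; case: eqP => [jp'|_].
- by move: pp; rewrite -jp -jp' eqxx.
- move: lp'; rewrite {1}/thickness -jp; case: (p'.2) => lp'; apply: le_Bmax; slra.
- move: h1; rewrite /hi /lo jp' eqxx; case: (p.2) => h1; rewrite -?jp' in h1 *; apply: le_minB; slra.
- by apply: le_minB; apply: le_Bmax; slra.
Qed.

Let slab_subset p : slab p `<=` Q' `\` Q''.
Proof.
move=> x Hx; split.
  move=> j; have := Hx j; rewrite /lo /hi; have := Aa_le j; have := aA_le j.
  case: eqP => [->|_]; first by case: (p.2); slra.
  by rewrite ge_max lt_min => ? ? /andP[/andP[-> _] /andP[-> _]].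
move=> /(_ p.1); have := Hx p.1; rewrite /lo /hi eqxx.
by case: (p.2); slra.
Qed.

(** Among the sides on which [x] lies outside [Q''], one with the largest distance is taken. In the
    other directions [x] is within that distance of [Q''], and the distance is at most the
    thickness. *)
Let slab_cover x : (Q' `\` Q'') x -> exists p, slab p x.
Proof.
move=> [Qx nQx].
pose out p := if p.2 then a p.1 + l <= tnth x p.1 else tnth x p.1 < a p.1.
pose gap p : R := if p.2 then tnth x p.1 - (a p.1 + l) else a p.1 - tnth x p.1.
have [p0 outp0] : exists p, out p.
  apply: contrapT => H; apply: nQx => i; apply/andP; split.
    by rewrite leNgt; apply/negP => h; apply: H; exists (i, false).
  by rewrite ltNge; apply/negP => h; apply: H; exists (i, true).
have [p outp Hp] := @Order.TotalTheory.arg_maxP _ _ _ p0 out gap outp0.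
have gap_le : gap p <= thickness p.
  by rewrite /gap /thickness; have := Qx p.1; case: (p.2); slra.
have th0 : 0 < thickness p.
  by move: outp; rewrite /out /thickness; have := Qx p.1; case: (p.2); slra.
have gap0 : 0 <= gap p by move: outp; rewrite /out /gap; case: (p.2); slra.
exists p => j; have /andP[Q1 Q2] := Qx j; rewrite /lo /hi; case: eqP => [jp|_].
  by move: outp; rewrite /out -jp; case: (p.2) => h; apply/andP; split; slra.
rewrite ge_max lt_min Q1 Q2 /=; apply/andP; split.
  rewrite leNgt; apply/negP => h.
  have : gap (j, false) <= gap p by apply: Hp; rewrite /out /=; slra.
  by rewrite {1}/gap /=; slra.
rewrite ltNge; apply/negP => h.
have : gap (j, true) <= gap p by apply: Hp; rewrite /out /=; slra.
by rewrite {1}/gap /=; slra.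
Qed.

(* The slabs on the far sides of Q'' in two different directions meet every other
   slab of a transversal direction in a comparable box; all slabs are glued to these. *)
Lemma ring_approx_aux k Cb Cg q f (eta : R) : (2 <= d)%N -> (1 <= q)%E ->
  measurable_fun setT f -> 0 <= eta -> 1 <= Cb -> 1 <= Cg ->
  (forall u v (l : R), 0 < l -> (forall i, l <= v i - u i <= 5%:R * l) ->
    cubes_approx k q f (box u v) eta -> poly_approx k q f (box u v) (Cb * eta)) ->
  (forall S1 S2 (l : R) u v u' v' (eta : R),
    measurable S1 -> measurable S2 -> 0 < l -> 0 <= eta ->
    (forall i, l <= v i - u i) ->
    (forall i, u i - 20%:R * l <= u' i) -> (forall i, v' i <= v i + 20%:R * l) ->
    box u v `<=` S1 -> box u v `<=` S2 -> S2 `<=` box u' v' ->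
    poly_approx k q f S1 eta -> poly_approx k q f S2 eta ->
    poly_approx k q f (S1 `|` S2) (Cg * eta)) ->
  cubes_approx k q f (Q' `\` Q'') eta ->
  poly_approx k q f (Q' `\` Q'') (Cg ^+ (d * 2).+1 * Cb * eta).
Proof.
move=> d2 q1 mf eta0 Cb1 Cg1 Hb Hg H.
have Cbeta : 0 <= Cb * eta by rewrite mulr_ge0//; slra.
have slab_approx p : l <= thickness p -> poly_approx k q f (slab p) (Cb * eta).
  move=> lp; apply: (Hb _ _ (thickness p)); first by slra.
    by move=> i; rewrite side_ge//= side_le.
  exact: cubes_approxS (@slab_subset p) H.
(* [p] is glued to [S] along its overlap with [p'], at the price of one factor [Cg]. The sides of
   [p] are at most 20 times [thickness p / 4], which explains the 20 in the gluing hypothesis. A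
   slab of thickness 0 adds nothing. *)
have step S n p p' : measurable S -> p.1 != p'.1 -> L / 4 <= thickness p' ->
    slab p' `<=` S -> poly_approx k q f S (Cg ^+ n * (Cb * eta)) ->
    poly_approx k q f (S `|` slab p) (Cg ^+ n.+1 * (Cb * eta)).
  move=> mS pp tp' S' HS.
  have Cn : 1 <= Cg ^+ n by rewrite exprn_ege1.
  have [tp0|tp] := thickness_or p.
    rewrite (_ : S `|` slab p = S).
      apply: poly_approx_le HS; rewrite ler_wpM2r// exprS ler_peMl//; slra.
    rewrite setUidl// => x /(_ p.1); rewrite /lo /hi eqxx.
    by move: tp0; rewrite /thickness; case: (p.2); slra.
  rewrite exprS -mulrA.
  apply: (Hg _ _ (thickness p / 4) (fun j => Num.max (lo p j) (lo p' j))
    (fun j => Num.min (hi p j) (hi p' j)) (lo p) (hi p)) => //.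
  - exact: measurable_box.
  - by slra.
  - by rewrite mulr_ge0//; slra.
  - by move=> j; exact: overlap.
  - move=> j; have := @overlap p p' j pp tp tp'; have := @side_le p j tp.
    have : Num.min (hi p j) (hi p' j) <= hi p j by rewrite ge_min lexx.
    by slra.
  - move=> j; have := @overlap p p' j pp tp tp'; have := @side_le p j tp.
    have : lo p j <= Num.max (lo p j) (lo p' j) by rewrite le_max lexx.
    by slra.
  - apply: subset_trans S'; apply: subset_box => j; first by rewrite le_max lexx orbT.
    by rewrite ge_min lexx orbT.
  - by apply: subset_box => j; [rewrite le_max lexx|rewrite ge_min lexx].
  - by apply: poly_approx_le (slab_approx _ tp); rewrite ler_peMl.
pose i0 : 'I_d := Ordinal (ltnW d2); pose i1 : 'I_d := Ordinal d2.
have [t0 far0] := far i0; have [t1 far1] := far i1.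
pose p0 := (i0, t0); pose p1 := (i1, t1).
pose U s := slab p0 `|` slab p1 `|` \big[setU/set0]_(p <- s) slab p.
have mU s : measurable (U s).
  apply: measurableU; first by apply: measurableU; exact: measurable_box.
  by elim/big_ind : _ => // *; [exact: measurableU|exact: measurable_box].
have key s : poly_approx k q f (U s) (Cg ^+ (size s).+1 * (Cb * eta)).
  elim: s => [|p s IH].
    rewrite /U big_nil setU0; apply: (step _ 0%N p1 p0) => //.
      exact: measurable_box.
    rewrite expr0 mul1r; apply: slab_approx.
    by case: (thickness_or p0) => // h; have : L / 4 <= thickness p0 := far0; slra.
  have -> : U (p :: s) = U s `|` slab p by rewrite /U big_cons [slab p `|` _]setUC setUA.
  have [pi0|pi0] := eqVneq p.1 i0.
    apply: (step _ _ p p1) => //; first by rewrite pi0.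
    by move=> x px; left; right.
  apply: (step _ _ p p0) => //.
  by move=> x px; left; left.
(* One factor for gluing [p1] to [p0] and one for each of the [d * 2] slabs. *)
have := key (enum {: 'I_d * bool}); rewrite -cardE card_prod card_ord card_bool mulrA.
rewrite (_ : U _ = Q' `\` Q'')//; apply/seteqP; split => x.
  rewrite /U -bigcup_seq => -[[|]|[p _]]; exact: slab_subset.
move=> /slab_cover[p px]; right; rewrite -bigcup_seq; exists p => //=.
by rewrite mem_enum.
Qed.

End slabs.

Lemma ring_approx k : (2 <= d)%N -> (0 < k)%N -> exists C : R, 1 <= C /\
  forall q f (A a : 'I_d -> R) (L l eta : R), (1 <= q)%E -> measurable_fun setT f ->
  0 <= eta -> 0 < l -> 2 * l <= L ->
  (forall i, a i = A i \/ A i + l <= a i) ->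
  (forall i, a i + l = A i + L \/ a i + l + l <= A i + L) ->
  cubes_approx k q f (box A (fun i => A i + L) `\` box a (fun i => a i + l)) eta ->
  poly_approx k q f (box A (fun i => A i + L) `\` box a (fun i => a i + l)) (C * eta).
Proof.
move=> d2 k0; have [Cb [Cb1 Hb]] := @approx_box R d k 5 k0.
have [Cg [Cg1 Hg]] := @approx_glue R d k 20 k0.
exists (Cg ^+ (d * 2).+1 * Cb); split; first by rewrite mulr_ege1// exprn_ege1.
move=> q f A a L l eta q1 mf eta0 l0 lL H1 H2 H.
apply: ring_approx_aux => //.
  by move=> u v r r0 *; exact: (Hb q f r).
by move=> S1 S2 r u v u' v' e *; exact: (Hg q f S1 S2 r u v u' v').
Qed.

End ring_approx.

(** * Dyadic cubes and their children *)

Section dyadic.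
Context {R : realType} {d : nat}.
Implicit Types (x : euclid R d) (f : euclid R d -> R) (S : set (euclid R d)) (q : \bar R)
  (alpha beta : d.-tuple int) (b : {ffun 'I_d -> bool}).

Lemma box_subset_le (u v u' v' : 'I_d -> R) : (forall i, u i < v i) ->
  box u v `<=` box u' v' -> forall i, u' i <= u i /\ v i <= v' i.
Proof.
move=> uv H i; split.
  have : box u v [tuple u i | i < d] by move=> j; rewrite tnth_mktuple lexx uv.
  by move=> /H/(_ i); rewrite tnth_mktuple => /andP[].
rewrite leNgt; apply/negP => vv.
have : box u v [tuple (if j == i then Num.max (u i) (v' i) else u j) | j < d].
  move=> j; rewrite tnth_mktuple; case: eqP => [->|_]; last by rewrite lexx uv.
  by rewrite le_max lexx gt_max uv vv.
by move=> /H/(_ i); rewrite tnth_mktuple eqxx gt_max ltxx !andbF.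
Qed.

Definition dyadic_corner (j : nat) alpha (i : 'I_d) : R := 2 ^- j * (tnth alpha i)%:~R.

Lemma dyadic_cube_box j alpha : dyadic_cube j alpha =
  box (dyadic_corner j alpha) (fun i => dyadic_corner j alpha i + 2 ^- j) :> set (euclid R d).
Proof. by apply/seteqP; split => x Hx i; have := Hx i; rewrite !tnth_mktuple. Qed.

Lemma dyadic_cube_neq0 j alpha : (dyadic_cube j alpha : set (euclid R d)) !=set0.
Proof.
exists [tuple dyadic_corner j alpha i | i < d]; rewrite dyadic_cube_box => i.
by rewrite tnth_mktuple lexx ltrDl invr_gt0 exprn_gt0.
Qed.

Lemma dyadic_cube_is_cube j alpha : is_cube (dyadic_cube j alpha : set (euclid R d)).
Proof. by exists [tuple dyadic_corner j alpha i | i < d], (2 ^- j); rewrite invr_gt0 exprn_gt0. Qed.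

Lemma dyadic_cube_subset j1 j2 alpha1 alpha2 :
  (dyadic_cube j2 alpha2 : set (euclid R d)) `<=` dyadic_cube j1 alpha1 -> forall i,
  dyadic_corner j1 alpha1 i <= dyadic_corner j2 alpha2 i /\
  dyadic_corner j2 alpha2 i + 2 ^- j2 <= dyadic_corner j1 alpha1 i + 2 ^- j1.
Proof.
rewrite !dyadic_cube_box; apply: box_subset_le => i.
by rewrite ltrDl invr_gt0 exprn_gt0.
Qed.

Let mul_int_or (l : R) (z : int) : 0 < l -> 0 <= l * z%:~R -> l * z%:~R = 0 \/ l <= l * z%:~R.
Proof.
move=> l0; rewrite pmulr_rge0// ler0z => z0.
have [->|zn0] := eqVneq z 0; first by left; rewrite mulr0.
by right; rewrite ler_peMr ?(ltW l0)// ler1z -gtz0_ge1 lt_def zn0.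
Qed.

(** Corner differences are integer multiples of the smaller side, so faces coincide or are at least
    that side apart; a strictly smaller dyadic cube has at most half the side. With [Q''] empty the
    ring is itself a cube. *)
Lemma dyadic_ring_approx k : (2 <= d)%N -> (0 < k)%N -> exists C : R, 1 <= C /\
  forall q f K (eta : R), (1 <= q)%E -> measurable_fun setT f -> 0 <= eta ->
  is_dyadic_ring K -> cubes_approx k q f K eta -> poly_approx k q f K (C * eta).
Proof.
move=> d2 k0; have [C [C1 HC]] := @ring_approx R d k d2 k0.
exists C; split => // q f K eta q1 mf eta0 [Q' [Q'' [[j1 [al1 [-> U1]]] HQ'' prop ->]]] H.
case: HQ'' => [Q0|[j2 [al2 [E2 U2]]]].
  rewrite Q0 setD0 in H *; apply: (@poly_approx_le _ _ _ _ _ _ eta); first by rewrite ler_peMl.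
  by apply: H => //; rewrite invr_gt0 exprn_gt0.
subst Q''.
have l0 j : (0 : R) < 2 ^- j by rewrite invr_gt0 exprn_gt0.
have sub := dyadic_cube_subset prop.1.
have i0 : 'I_d by exact: Ordinal (ltnW d2).
have lL : 2 ^- j2 <= 2 ^- j1 :> R by have [] := sub i0; lra.
have jj : (j1 <= j2)%N.
  by move: lL; rewrite lef_pV2 ?posrE ?exprn_gt0// ler_eXn2l// ltr1n.
have {}jj : (j1 < j2)%N.
  rewrite ltn_neqAle jj andbT; apply/eqP => j12; subst j2.
  apply: prop.2 => x; rewrite !dyadic_cube_box => Hx i; have := Hx i; have [] := sub i.
  by move=> ? ? /andP[? ?]; apply/andP; split; lra.
have LE : 2 ^- j1 = 2 ^- j2 * (2 ^+ (j2 - j1) : int)%:~R :> R.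
  by rewrite rmorphXn /= -[in 2 ^- j2](subnK (ltnW jj)) exprD invfM mulrAC
    mulVf ?mul1r ?expf_neq0// pnatr_eq0.
rewrite !dyadic_cube_box in H *.
apply: HC => //.
- rewrite LE mulrC ler_pM2l// (ler_int _ 2).
  by rewrite -{1}(expr1 (2 : int)) ler_eXn2l// subn_gt0.
- move=> i; have [h _] := sub i.
  have E : dyadic_corner j2 al2 i - dyadic_corner j1 al1 i =
    2 ^- j2 * (tnth al2 i - 2 ^+ (j2 - j1) * tnth al1 i)%:~R.
    by rewrite /dyadic_corner LE rmorphB rmorphM /= mulrBr mulrA.
  have := @mul_int_or (2 ^- j2) (tnth al2 i - 2 ^+ (j2 - j1) * tnth al1 i) (l0 _).
  by rewrite -E; case; [lra|left; lra|right; lra].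
- move=> i; have [_ h] := sub i.
  have E : dyadic_corner j1 al1 i + 2 ^- j1 - (dyadic_corner j2 al2 i + 2 ^- j2) =
    2 ^- j2 * (2 ^+ (j2 - j1) * (tnth al1 i + 1) - (tnth al2 i + 1))%:~R.
    rewrite /dyadic_corner LE rmorphB rmorphM /= !rmorphD /= mulr1z; ring.
  have := @mul_int_or (2 ^- j2) (2 ^+ (j2 - j1) * (tnth al1 i + 1) - (tnth al2 i + 1)) (l0 _).
  by rewrite -E; case; [lra|left; lra|right; lra].
Qed.

Definition child alpha b : d.-tuple int := [tuple (2 * tnth alpha i + (b i : nat)%:Z)%R | i < d].

Lemma child_corner j alpha b i : dyadic_corner j.+1 (child alpha b) i =
  dyadic_corner j alpha i + (b i)%:R * 2 ^- j.+1.
Proof.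
rewrite /dyadic_corner tnth_mktuple rmorphD rmorphM /= mulrDr; congr (_ + _); last by rewrite mulrC.
by rewrite exprS invfM mulrA mulrAC -[X in X * _ * _]mulrC; field.
Qed.

Lemma pow2V_succ (j : nat) : 2 ^- j = 2 ^- j.+1 + 2 ^- j.+1 :> R.
Proof. by rewrite exprS invfM; field. Qed.

Lemma child_subset j alpha b :
  (dyadic_cube j.+1 (child alpha b) : set (euclid R d)) `<=` dyadic_cube j alpha.
Proof.
rewrite !dyadic_cube_box; have l0 : (0 : R) < 2 ^- j.+1 by rewrite invr_gt0 exprn_gt0.
by apply: subset_box => i; rewrite child_corner ?(pow2V_succ j); case: (b i) => /=; lra.
Qed.

Lemma child_disjoint j alpha b b' x : (dyadic_cube j.+1 (child alpha b)) x ->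
  (dyadic_cube j.+1 (child alpha b')) x -> b = b'.
Proof.
rewrite !dyadic_cube_box => Hb Hb'; apply/ffunP => i.
have l0 : (0 : R) < 2 ^- j.+1 by rewrite invr_gt0 exprn_gt0.
by have := Hb i; have := Hb' i; rewrite !child_corner; case: (b i); case: (b' i) => //=; lra.
Qed.

Lemma child_cover j alpha x : dyadic_cube j alpha x ->
  exists b, dyadic_cube j.+1 (child alpha b) x.
Proof.
rewrite dyadic_cube_box => Hx.
exists [ffun i => dyadic_corner j alpha i + 2 ^- j.+1 <= tnth x i].
rewrite dyadic_cube_box => i; have /andP[h1] := Hx i; rewrite child_corner ffunE (pow2V_succ j) => h2.
by case: (leP (dyadic_corner j alpha i + 2 ^- j.+1) (tnth x i)) => /= h3; apply/andP; split; lra.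
Qed.

End dyadic.

(** * Finite families of disjoint sets *)

Section families.
Context {T : Type}.
Implicit Types (A : set T) (s : seq (set T)).

(** Sequences give sizes and concatenation. Members are nonempty so that concatenating families over
    disjoint sets creates no duplicates. *)
Definition disj_family A s := [/\ uniq s, forall K, K \in s -> K `<=` A,
  forall K, K \in s -> K !=set0 &
  forall x K1 K2, K1 \in s -> K2 \in s -> K1 x -> K2 x -> K1 = K2].

Lemma disj_familyS A B s : A `<=` B -> disj_family A s -> disj_family B s.
Proof.
by move=> AB [u sA n dj]; split => // K /sA; move/subset_trans; apply.
Qed.

Lemma disj_family0 A : disj_family A [::].
Proof. by split. Qed.

Lemma disj_family1 A K : K `<=` A -> K !=set0 -> disj_family A [:: K].
Proof.
move=> KA K0; split => //; try by move=> K'; rewrite mem_seq1 => /eqP ->.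
by move=> x K1 K2; rewrite !mem_seq1 => /eqP -> /eqP ->.
Qed.

Lemma disj_family_cat A1 A2 s1 s2 : (forall x, A1 x -> A2 x -> False) ->
  disj_family A1 s1 -> disj_family A2 s2 -> disj_family (A1 `|` A2) (s1 ++ s2).
Proof.
move=> A12 [u1 sA1 n1 dj1] [u2 sA2 n2 dj2]; split.
- rewrite cat_uniq u1 u2 andbT; apply/hasPn => K Ks2; apply/negP => Ks1.
  by have [x Kx] := n1 _ Ks1; apply: (A12 x); [exact: sA1 Kx|exact: sA2 Kx].
- by move=> K; rewrite mem_cat => /orP[/sA1|/sA2] KA x /KA; [left|right].
- by move=> K; rewrite mem_cat => /orP[/n1|/n2].
- move=> x K1 K2; rewrite !mem_cat => /orP[H1|H1] /orP[H2|H2] K1x K2x.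
  + exact: dj1 K1x K2x.
  + by case: (A12 x); [exact: sA1 K1x|exact: sA2 K2x].
  + by case: (A12 x); [exact: sA1 K2x|exact: sA2 K1x].
  + exact: dj2 K1x K2x.
Qed.

Lemma disj_family_flatten (I : eqType) (r : seq I) (F : I -> set T) (G : I -> seq (set T)) :
  uniq r -> (forall x i j, F i x -> F j x -> i = j) ->
  (forall i, disj_family (F i) (G i)) ->
  disj_family (\bigcup_(i in [set` r]) F i) (flatten [seq G i | i <- r]).
Proof.
move=> ur dF FG; elim: r ur => [_|i r IH /= /andP[ir ur]]; first exact: disj_family0.
apply: disj_familyS (disj_family_cat _ (FG i) (IH ur)).
  move=> x [Fx|[j /= jr Fx]]; [exists i => //=|exists j => //=]; rewrite inE ?eqxx//.
  by rewrite jr orbT.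
move=> x Fix [j /= jr Fjx]; move: ir; rewrite (dF _ _ _ Fix Fjx).
by rewrite jr.
Qed.

End families.

(** * Partitions into good rings *)

Section ring_tree.
Context {R : realType} {d : nat}.
(** [big] stands for a best approximation above the threshold, [J] for a level whose dyadic cubes
    are all good; with [f] abstracted away, the counting is purely combinatorial. *)
Variables (big : set (euclid R d) -> Prop) (J : nat).
Implicit Types (S K : set (euclid R d)).
Local Notation D j alpha := (dyadic_cube j alpha : set (euclid R d)).

Definition bad S := exists K, [/\ is_cube K, K `<=` S & big K].

Lemma cube_neq0 K : is_cube K -> K !=set0.
Proof.
move=> [a [r [r0 ->]]]; exists a => i.
by rewrite lexx ltrDl.
Qed.

Hypothesis J_good : forall alpha, D J alpha `<=` unit_cube ->
  ~ bad (D J alpha).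

(* L is a family of disjoint big cubes, whose size controls that of the partition P
   into good rings. *)
Definition good_partition S (L P : seq (set (euclid R d))) := [/\
  disj_family S L /\ (forall K, K \in L -> is_cube K /\ big K),
  disj_family S P /\ (forall K, K \in P -> is_dyadic_ring K /\ ~ bad K),
  forall x, S x -> exists2 K, K \in P & K x &
  L = [::] /\ size P = 1%N \/ (size P + 2 ^ d <= (2 ^ d.+1).+1 * size L)%N].

Lemma exists_good_partition_good j alpha : D j alpha `<=` unit_cube ->
  ~ bad (D j alpha) -> good_partition (D j alpha) [::] [:: D j alpha].
Proof.
move=> U nb; have n0 := @dyadic_cube_neq0 R d j alpha.
have rK : is_dyadic_ring (D j alpha).
  exists (D j alpha), set0; rewrite setD0; split => //.
  - by exists j, alpha.
  - by left.
  - by split => // h; have [x] := n0; exact: h.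
split => //.
- by split; [exact: disj_family1|move=> K; rewrite mem_seq1 => /eqP ->].
- by move=> x Qx; exists (D j alpha); rewrite ?mem_seq1.
- by left.
Qed.

Let sum_size (I : finType) (T : Type) (F : I -> seq T) (b : seq I) :
  size (flatten [seq F i | i <- b]) = (\sum_(i <- b) size (F i))%N.
Proof. by rewrite size_flatten /shape -map_comp sumnE big_map. Qed.

(** The summand [2 ^ d] in the size bound is a reserve held by each nonempty family [L]. If two or
    more children have one, the surplus reserve pays for the undivided children and the ring. If at
    most one has, a cube outside that child raises [size L] by one, and [2 ^ d.+1 + 1] pays for at
    most [2 ^ d] undivided children, one ring and a new reserve: this fixes the constant. *)
Lemma exists_good_partition n j alpha : (j <= J)%N -> (J - j <= n)%N ->
  D j alpha `<=` unit_cube -> exists L P, good_partition (D j alpha) L P.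
Proof.
elim: n j alpha => [|n IH] j alpha jJ Jj U.
  have jE : j = J by apply/eqP; rewrite eqn_leq jJ -subn_eq0 -leqn0.
  subst j; do 2!eexists; apply: exists_good_partition_good => //; exact: J_good.
have [nb|] := pselect (~ bad (dyadic_cube j alpha)).
  by do 2!eexists; exact: exists_good_partition_good.
move=> /contrapT bQ; set Q : set (euclid R d) := dyadic_cube j alpha in U bQ *.
(* Level [j] qualifies, since an empty difference contains no cube, and [J] bounds the levels, so a
   largest one exists. *)
pose good_level i := `[< (i <= J)%N /\ exists beta,
  dyadic_cube i beta `<=` Q /\ ~ bad (Q `\` dyadic_cube i beta) >].
have ex : exists i, good_level i.
  exists j; apply/asboolP; split => //; exists alpha; split => //.
  rewrite setDv => -[K [cK K0 _]]; have [x Kx] := cube_neq0 cK; exact: K0 Kx.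
have ub i : good_level i -> (i <= J)%N by move=> /asboolP[].
case: (ex_maxnP ex ub) => i /asboolP[iJ [beta [Qs nbQs]]] imax {ex ub}.
have ji : (j <= i)%N.
  apply: imax; apply/asboolP; split => //; exists alpha; split => //.
  rewrite setDv => -[K [cK K0 _]]; have [x Kx] := cube_neq0 cK; exact: K0 Kx.
(* Maximality of i makes Q minus any child of Qstar bad. *)
pose Qstar : set (euclid R d) := dyadic_cube i beta.
have Us : Qstar `<=` unit_cube := subset_trans Qs U.
(* Members of a family are nonempty, so the ring is left out when [Qstar] is all of [Q]. *)
pose R0 := if `[< Qstar = Q >] then [::] else [:: Q `\` Qstar].
have sR0 : (size R0 <= 1)%N by rewrite /R0; case: asboolP.
have famR0 : disj_family (Q `\` Qstar) R0.
  rewrite /R0; case: asboolP => [eqQ|ne]; first exact: disj_family0.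
  apply: disj_family1 => //; apply/set0P/eqP => h; apply: ne.
  by apply/seteqP; split => //; rewrite -setD_eq0.
have R0P K : K \in R0 -> is_dyadic_ring K /\ ~ bad K.
  rewrite /R0; case: asboolP => // ne; rewrite mem_seq1 => /eqP ->; split => //.
  exists Q, Qstar; split => //.
  - by exists j, alpha.
  - by right; exists i, beta.
  - by split => // h; apply: ne; apply/seteqP; split.
have R0cov x : Q x -> ~ Qstar x -> exists2 K, K \in R0 & K x.
  rewrite /R0; case: asboolP => [->//|ne] Qx nQx.
  by exists (Q `\` Qstar); rewrite ?mem_seq1.
have disj x : (Q `\` Qstar) x -> Qstar x -> False by case.
have QE : (Q `\` Qstar) `|` Qstar `<=` Q by move=> x [[Qx _]|/Qs].
(* At the finest level [Qstar] is good, and one cube witnessing that [Q] is bad suffices for [L]. *)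
have [iJ'|iJ'] := eqVneq i J.
  have nbs : ~ bad Qstar by rewrite /Qstar; subst i; exact: J_good.
  have [[_ _] [fP PP] Pcov _] := exists_good_partition_good Us nbs.
  have [K [cK KQ bK]] := bQ.
  exists [:: K], (R0 ++ [:: Qstar]); split.
  - split; first by apply: disj_family1 => //; exact: cube_neq0.
    by move=> K'; rewrite mem_seq1 => /eqP ->.
  - split; first by apply: disj_familyS QE _; exact: disj_family_cat.
    by move=> K'; rewrite mem_cat => /orP[/R0P|/PP].
  - move=> x Qx; have [Sx|Sx] := pselect (Qstar x).
      by exists Qstar => //; rewrite mem_cat mem_seq1 eqxx orbT.
    by have [K' K'R K'x] := R0cov x Qx Sx; exists K' => //; rewrite mem_cat K'R.
  - right; rewrite size_cat /= muln1 expnS; move: sR0; have := expn_gt0 2 d; lia.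
have iltJ : (i < J)%N by rewrite ltn_neqAle iJ' iJ.
pose Qc (b : {ffun 'I_d -> bool}) : set (euclid R d) := dyadic_cube i.+1 (child beta b).
have QcS b : Qc b `<=` Qstar by exact: child_subset.
have Qcbad b : bad (Q `\` Qc b).
  apply: contrapT => nb; have /imax : good_level i.+1.
    apply/asboolP; split => //; exists (child beta b); split => //.
    exact: subset_trans (QcS b) Qs.
  by rewrite ltnn.
have Qcdisj x b b' : Qc b x -> Qc b' x -> b = b' by exact: child_disjoint.
have /choice[LP HLP] : forall b, exists LP : seq (set (euclid R d)) * seq (set (euclid R d)),
    good_partition (Qc b) LP.1 LP.2.
  move=> b; have [||L [P LPb]] := IH i.+1 (child beta b) iltJ.
  - lia.
  - exact: subset_trans (QcS b) Us.
  - by exists (L, P).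
pose bs := enum {: {ffun 'I_d -> bool}}.
have szbs : size bs = (2 ^ d)%N by rewrite /bs -cardE card_ffun card_bool card_ord.
have ubs : uniq bs by exact: enum_uniq.
have inbs b : b \in bs by rewrite mem_enum.
pose P0 := flatten [seq (LP b).2 | b <- bs].
have famP b : disj_family (Qc b) (LP b).2 by have [_ []] := HLP b.
have famL0 b : disj_family (Qc b) (LP b).1 by have [[]] := HLP b.
have famP0 : disj_family Qstar P0.
  apply: disj_familyS (disj_family_flatten ubs Qcdisj famP).
  by move=> x [b _ /QcS].
have P0P K : K \in P0 -> is_dyadic_ring K /\ ~ bad K.
  move=> /flattenP[_ /mapP[b _ ->]]; have [_ [_ h] _ _] := HLP b; exact: h.
have PP : disj_family Q (R0 ++ P0) /\ (forall K, K \in R0 ++ P0 -> is_dyadic_ring K /\ ~ bad K).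
  split; first by apply: disj_familyS QE _; exact: disj_family_cat.
  by move=> K'; rewrite mem_cat => /orP[/R0P|/P0P].
have Pcov x : Q x -> exists2 K, K \in R0 ++ P0 & K x.
  move=> Qx; have [Sx|Sx] := pselect (Qstar x); last first.
    by have [K' K'R K'x] := R0cov x Qx Sx; exists K' => //; rewrite mem_cat K'R.
  have [b Qbx] := child_cover Sx; have [_ _ /(_ _ Qbx)[K KP Kx] _] := HLP b.
  exists K => //; rewrite mem_cat; apply/orP; right; apply/flattenP.
  by exists (LP b).2 => //; apply/mapP; exists b.
pose sL := (\sum_(b <- bs) size (LP b).1)%N.
pose nz b := (LP b).1 != [::].
(* Relative to one piece per child, each nonempty family saves [(2 ^ d).+1]. *)
have count_le r : (\sum_(b <- r) size (LP b).2 + (2 ^ d).+1 * count nz r <=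
    (2 ^ d.+1).+1 * \sum_(b <- r) size (LP b).1 + size r)%N.
  elim: r => [|b r IHr]; first by rewrite !big_nil /= !muln0.
  rewrite !big_cons /=; have [_ _ _] := HLP b; rewrite {1}/nz.
  case: eqP => [->|/eqP h] [[h' h'']|h'] /=; move: IHr; rewrite ?mulnDr /=.
  - by rewrite h''; lia.
  - by move: h'; rewrite /= muln0; have := expn_gt0 2 d; lia.
  - by rewrite h' in h.
  - by lia.
have := count_le bs; rewrite szbs -/sL.
have szP0 : size P0 = (\sum_(b <- bs) size (LP b).2)%N by exact: sum_size.
have famL b K : K \in (LP b).1 -> is_cube K /\ big K.
  by have [[_ h] _ _ _] := HLP b; exact: h.
have [c2 HP0|c1 HP0] := leqP 2 (count nz bs).
  exists (flatten [seq (LP b).1 | b <- bs]), (R0 ++ P0); split => //.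
    split.
      apply: disj_familyS (disj_family_flatten ubs Qcdisj famL0).
      by move=> x [b _ /QcS/Qs].
    by move=> K /flattenP[_ /mapP[b _ ->]]; exact: famL.
  right; rewrite size_cat szP0 sum_size -/sL.
  have : ((2 ^ d).+1 * 2 <= (2 ^ d).+1 * count nz bs)%N by rewrite leq_mul2l c2 orbT.
  move: sR0 HP0; rewrite muln2 -addnn.
  move: (size R0) (\sum_(b <- bs) size (LP b).2)%N ((2 ^ d).+1 * count nz bs)%N
    ((2 ^ d.+1).+1 * sL)%N (2 ^ d)%N => *; lia.
(* Only [b0] may have a nonempty family, so a big cube taken outside [Qc b0] is disjoint from all
   cubes collected so far. If all families are empty, any [b0] will do. *)
have [b0 Hb0] : exists b0, forall b, b != b0 -> (LP b).1 = [::].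
  move: c1; rewrite -size_filter; case E : ([seq b <- bs | nz b]) => [|b0 [|b1 r]] // _.
    exists [ffun=> false] => b _; apply/eqP; apply/negPn/negP => h.
    by have : b \in [seq b <- bs | nz b] by [rewrite mem_filter inbs andbT]; rewrite E.
  exists b0 => b bb0; apply/eqP; apply/negPn/negP => h.
  have : b \in [seq b <- bs | nz b] by rewrite mem_filter inbs andbT.
  by rewrite E mem_seq1 (negPf bb0).
have sLE : sL = size (LP b0).1.
  rewrite /sL (bigD1_seq b0)//= big1 ?addn0// => b /Hb0 ->//.
have [K [cK KQ bK]] := Qcbad b0.
have [[famLb0 _] _ _ _] := HLP b0.
exists (K :: (LP b0).1), (R0 ++ P0); split => //.
  split; last first.
    by move=> K'; rewrite inE => /orP[/eqP ->//|]; exact: famL.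
  have fK : disj_family (Q `\` Qc b0) [:: K] by apply: disj_family1 => //; exact: cube_neq0.
  have dj x : (Q `\` Qc b0) x -> Qc b0 x -> False by case.
  apply: disj_familyS (disj_family_cat dj fK famLb0).
  by move=> x [[Qx _]|/QcS/Qs].
right; rewrite size_cat szP0 /= -sLE.
move: sR0 HP0; rewrite mulnS expnS mul2n -addnn.
by move: (size R0) (\sum_(b <- bs) size (LP b).2)%N ((2 ^ d).+1 * count nz bs)%N
  ((2 ^ d + 2 ^ d).+1 * sL)%N (2 ^ d)%N => *; lia.
Qed.

End ring_tree.

(** * Best approximation on small cubes *)

Section small_cubes.
Context {R : realType} {d : nat}.
Implicit Types (f : euclid R d -> R) (S K : set (euclid R d)) (q : \bar R).
Local Notation mu := (lebesgue_euclid R d).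
Local Notation D j alpha := (dyadic_cube j alpha : set (euclid R d)).

Lemma best_approx_ge0 k f S q : (0 <= best_approx k f S q)%E.
Proof. by apply: le_ereal_inf_tmp => _ [m _ <-]; exact: normLq_ge0. Qed.

Lemma best_approx_le k f S q m : polys k.-1 m ->
  (best_approx k f S q <= normLq q S (fun x => f x - peval m x)%R)%E.
Proof. by move=> Pm; apply: ereal_inf_lbound; exists m. Qed.

Lemma measurable_cube K : is_cube K -> measurable K.
Proof. by move=> [a [r [_ ->]]]; rewrite cube_box; exact: measurable_box. Qed.

(** Already the polynomial 0 is good enough: by absolute continuity of the integral of [|f| ^ r],
    the norm of [f] is small on sets of small measure such as the cubes of level [J]. *)
Lemma best_approx_small_fin k (r : R) f (e : R) : (0 < d)%N -> 1 <= r ->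
  measurable_fun setT f -> (normLq r%:E unit_cube f < +oo)%E -> 0 < e ->
  exists J, forall alpha K, D J alpha `<=` unit_cube -> is_cube K -> K `<=` D J alpha ->
  (best_approx k f K r%:E <= e%:E)%E.
Proof.
move=> d0 r1 mf fin e0; have r0 : 0 < r by lra.
have q1 : (1 <= r%:E)%E by rewrite lee_fin.
have mU : measurable (unit_cube : set (euclid R d)) := measurable_unit_cube.
pose g x := `|f x * \1_unit_cube x| `^ r.
have mg : measurable_fun setT g.
  apply: (@measurableT_comp _ _ _ _ _ _ (@powR R ^~ r)) => //.
  by apply: measurableT_comp => //; exact: measurable_mul_indic.
have ig : mu.-integrable setT (EFin \o g).
  apply/integrableP; split; first exact/measurable_EFinP.
  under eq_integral => x _ do rewrite /= ger0_norm ?powR_ge0//.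
  by rewrite -poweR_normLq// poweR_lty.
have er0 : 0 < e `^ r by rewrite powR_gt0.
have [dl [dl0 Hdl]] := integral_normr_continuous ig er0.
pose J := Num.truncn dl^-1.
have HJ : (2 ^- J) ^+ d < dl.
  apply: (@le_lt_trans _ _ (2 ^- J)).
    have h0 : (0 : R) <= 2 ^- J by rewrite invr_ge0 exprn_ge0.
    have h1 : 2 ^- J <= 1 :> R by rewrite invf_le1 ?exprn_gt0// exprn_ege1// ler1n.
    by rewrite -[leRHS]expr1; exact: ler_wiXn2l.
  rewrite -[ltRHS]invrK ltf_pV2 ?posrE ?exprn_gt0 ?invr_gt0//.
  apply: lt_le_trans (truncnS_gt _) _; rewrite -/J -natrX ler_nat.
  exact: ltn_expl.
exists J => alpha K DU cK KD.
have mD : measurable (D J alpha) by apply: measurable_cube; exact: dyadic_cube_is_cube.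
have mK := measurable_cube cK.
apply: le_trans (best_approx_le _ _ _ (polys0 _)) _.
rewrite (@normLq_congr _ _ _ _ _ f); last by move=> x _; rewrite peval0 subr0.
apply: le_trans (normLqS mK mD mf q1 KD) _.
have muD : (mu (D J alpha) < dl%:E)%E.
  by rewrite lebesgue_cube ?lte_fin// invr_gt0 exprn_gt0.
have := Hdl _ mD muD.
rewrite /Rintegral (eq_integral (fun x => (g x)%:E)); last first.
  by move=> x _; rewrite ger0_norm// powR_ge0.
have E : (\int[mu]_(x in D J alpha) (g x)%:E = normLq r%:E (D J alpha) f `^ r)%E.
  rewrite poweR_normLq// integral_mkcond; apply: eq_integral => x _.
  rewrite patchE /g indicE; case: ifPn => [|] xD.
    by rewrite !indicE xD mem_set//; apply: DU; exact: set_mem.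
  by rewrite indicE (negbTE xD) mulr0 normr0 powR0// gt_eqF.
rewrite E fine_poweR => h.
have Nfin : normLq r%:E (D J alpha) f \is a fin_num.
  rewrite ge0_fin_numE ?normLq_ge0//; apply: le_lt_trans fin.
  exact: normLqS.
rewrite -(fineK Nfin) lee_fin leNgt; apply/negP => h'.
have : e `^ r < fine (normLq r%:E (D J alpha) f) `^ r.
  by apply: gt0_ltr_powR => //; rewrite nnegrE ?(ltW e0)// fine_ge0// normLq_ge0.
by rewrite ltNge (ltW h).
Qed.

(** The constant [f x0], for a point [x0] of the dyadic cube, is uniformly close to [f] on it. *)
Lemma best_approx_small_infty k f (e : R) :
  measurable_fun setT f -> unif_continuous_on unit_cube f -> 0 < e ->
  exists J, forall alpha K, D J alpha `<=` unit_cube -> is_cube K -> K `<=` D J alpha ->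
  (best_approx k f K +oo <= e%:E)%E.
Proof.
move=> mf uc e0; have [dl dl0 Hdl] := uc e e0.
pose J := Num.truncn dl^-1.
have HJ : 2 ^- J < dl.
  rewrite -[ltRHS]invrK ltf_pV2 ?posrE ?exprn_gt0 ?invr_gt0//.
  apply: lt_le_trans (truncnS_gt _) _; rewrite -/J -natrX ler_nat.
  exact: ltn_expl.
exists J => alpha K DU cK KD; have [x0 Dx0] := @dyadic_cube_neq0 R d J alpha.
have Pc : polys k.-1 (mpoly.mpolyC d (f x0)).
  by rewrite /polys /= msizeC; case: (_ != 0).
apply: le_trans (best_approx_le _ _ _ Pc) _.
apply/normLq_infty_le; first exact: ltW.
right; apply: nearW => x; rewrite /peval mevalC indicE.
have [Kx|Kx] := pselect (K x); last by rewrite memNset// mulr0 normr0 ltW.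
rewrite mem_set// mulr1; apply/ltW/Hdl; [exact/DU/KD|exact: DU|] => i.
have := Dx0; have := KD _ Kx; rewrite dyadic_cube_box => /(_ i)/andP[h1 h2] /(_ i)/andP[h3 h4].
by rewrite (le_lt_trans _ HJ)// ler_norml; apply/andP; split; lra.
Qed.

Variables (p : R) (q : \bar R) (k : nat) (f : euclid R d -> R).
Hypothesis p1 : 1 <= p.
Local Notation e K := (best_approx k f K q).

Lemma seminormV_ge0 : (0 <= seminormV p q k f)%E.
Proof.
apply: le_ereal_sup_tmp; exists (0 `^ p^-1)%E; last by rewrite poweR_ge0.
by exists set0; [split => //; exact: trivIset_set0|rewrite esum_set0].
Qed.

Lemma sum_best_approx_le (L : seq (set (euclid R d))) :
  disj_family unit_cube L -> (forall K, K \in L -> is_cube K) ->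
  (\sum_(K <- L) e K `^ p <= seminormV p q k f `^ p)%E.
Proof.
move=> [uL LU nL dL] cL; have p0 : 0 < p := lt_le_trans ltr01 p1.
have h : ((\sum_(K <- L) e K `^ p) `^ p^-1 <= seminormV p q k f)%E.
  apply: ereal_sup_ubound; exists [set` L].
    split => [K /= KL|]; first by split; [exact: cL|exact: LU].
    by move=> K1 K2 /= K1L K2L [x [K1x K2x]]; exact: dL K1x K2x.
  rewrite esum_fset.
  - by rewrite -fsbig_seq.
  - exact: finite_seq.
  - by move=> K _; exact: poweR_ge0.
have s0 : (0 <= \sum_(K <- L) e K `^ p)%E.
  by apply: sume_ge0 => K _; exact: poweR_ge0.
rewrite -[leLHS]poweRe1// -(mulVf (lt0r_neq0 p0)) poweRrM.
apply: gt0_ler_poweR h; first exact: ltW.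
  by rewrite in_itv /= leey poweR_ge0.
by rewrite in_itv /= leey seminormV_ge0.
Qed.

Lemma best_approx_le_seminormV K : is_cube K -> K `<=` unit_cube ->
  (e K <= seminormV p q k f)%E.
Proof.
move=> cK KU; have p0 : 0 < p := lt_le_trans ltr01 p1.
have := @sum_best_approx_le [:: K]; rewrite big_seq1 => h.
have {}h : (e K `^ p <= seminormV p q k f `^ p)%E.
  apply: h; first by apply: disj_family1 => //; exact: cube_neq0.
  by move=> K'; rewrite mem_seq1 => /eqP ->.
have ek0 := best_approx_ge0 k f K q.
rewrite -[leLHS]poweRe1// -[leRHS]poweRe1 ?seminormV_ge0//.
rewrite -(mulfV (lt0r_neq0 p0)) !poweRrM.
apply: gt0_ler_poweR h; first by rewrite invr_ge0 ltW.
  by rewrite in_itv /= leey poweR_ge0.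
by rewrite in_itv /= leey poweR_ge0.
Qed.

End small_cubes.

(** * Piecewise polynomials *)

Section assembly.
Context {R : realType} {d : nat}.
Implicit Types (f : euclid R d -> R) (S K : set (euclid R d)) (q : \bar R)
  (P : seq (set (euclid R d))) (m : set (euclid R d) -> mpoly.mpoly d R).

Definition piecewise P m (x : euclid R d) : R := \sum_(K <- P) peval (m K) x * \1_K x.

Lemma piecewise_in P m A K x : disj_family A P -> K \in P -> K x ->
  piecewise P m x = peval (m K) x.
Proof.
move=> [uP _ _ dP] KP Kx; rewrite /piecewise (bigD1_seq K)//= big1_seq.
  by rewrite addr0 indicE mem_set// mulr1.
move=> K' /andP[K'K K'P]; rewrite indicE memNset ?mulr0// => K'x.
by move: K'K; rewrite (dP x K' K) ?eqxx.
Qed.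

Lemma bigsetU_family P A : disj_family A P -> (forall x, A x -> exists2 K, K \in P & K x) ->
  \big[setU/set0]_(K <- P) K = A.
Proof.
move=> [_ PA _ _] cov; rewrite -bigcup_seq; apply/seteqP; split => x.
  by move=> [K /= KP Kx]; exact: PA Kx.
by move=> /cov[K KP Kx]; exists K.
Qed.

Lemma partition_piecewise P m N l : disj_family unit_cube P ->
  (forall K, K \in P -> is_dyadic_ring K) ->
  (forall x : euclid R d, unit_cube x -> exists2 K, K \in P & K x) ->
  (forall K, K \in P -> polys l (m K)) -> (size P <= N)%N ->
  ring_partition N [set` P] /\ piecewise_polys l [set` P] (piecewise P m).
Proof.
move=> fP rP cP mP sP; have [uP _ nP dP] := fP; split; [split|] => //.
- by rewrite bigcup_seq (bigsetU_family fP).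
- by move=> K1 K2 /= K1P K2P [x [K1x K2x]]; exact: dP K1x K2x.
- apply: card_le_trans (_ : `I_(size P) #<= `I_N)%card; last by rewrite card_le_II.
  rewrite (_ : [set` P] = nth set0 P @` `I_(size P)); first exact: card_image_le.
  apply/seteqP; split => [K /= KP|_ [i /= iP <-]]; last exact: mem_nth.
  by exists (index K P); rewrite /= ?index_mem// nth_index.
- exists m => // x; rewrite -fsbig_seq//.
Qed.

Let sum_pick (s : seq (set (euclid R d))) (A : set (euclid R d)) (F : set (euclid R d) -> R) :
  uniq s -> \sum_(Q <- s) (if A == Q then F Q else 0) = if A \in s then F A else 0.
Proof.
move=> us; case: ifPn => As.
  rewrite (bigD1_seq A)//= eqxx big1 ?addr0// => Q.
  by rewrite eq_sym => /negPf ->.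
rewrite big1_seq// => Q /= Qs; case: eqP => // AQ.
by move: As; rewrite AQ Qs.
Qed.

Lemma covering_piecewise P m N l : disj_family unit_cube P ->
  (forall K, K \in P -> is_dyadic_ring K) ->
  (forall x : euclid R d, unit_cube x -> exists2 K, K \in P & K x) ->
  (forall K, K \in P -> polys l (m K)) -> (size P + size P <= N)%N ->
  exists2 D, dyadic_covering N D & piecewise_polys l D (piecewise P m).
Proof.
move=> fP rP cP mP sP; have [uP PU nP dP] := fP.
have /choice[QQ HQQ] : forall K, exists QQ : set (euclid R d) * set (euclid R d),
    K \in P -> [/\ is_dyadic_subcube QQ.1, QQ.2 = set0 \/ is_dyadic_subcube QQ.2,
      QQ.2 `<` QQ.1 & K = QQ.1 `\` QQ.2].
  move=> K; have [/rP[Q' [Q'' H]]|h] := boolP (K \in P); first by exists (Q', Q'').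
  by exists (set0, set0).
pose Qp K := (QQ K).1; pose Qm K := (QQ K).2.
(* Rings may share cubes and [Q''] may be empty; the covering lists each cube once and only nonempty
   ones. *)
pose s := [seq Q <- undup (map Qp P ++ map Qm P) | Q != set0].
have us : uniq s by rewrite filter_uniq// undup_uniq.
have sQ Q : Q \in s -> is_dyadic_subcube Q.
  rewrite mem_filter mem_undup mem_cat => /andP[Q0 /orP[]] /mapP[K KP QE].
    by rewrite QE; have [] := HQQ K KP.
  have [_ [h|h] _ _] := HQQ K KP; last by rewrite QE.
  by move: Q0; rewrite QE /Qm h eqxx.
have Qps K : K \in P -> Qp K \in s.
  move=> KP; rewrite mem_filter mem_undup mem_cat map_f// andbT.
  have [[j [al [E _]]] _ _ _] := HQQ K KP; rewrite /Qp E.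
  exact/set0P/dyadic_cube_neq0.
exists [set` s].
  split => [Q /sQ//||].
    apply/seteqP; split => x.
      by move=> [Q /sQ[j [al [_ QU]]] Qx]; exact: QU.
    move=> /cP[K KP Kx]; exists (Qp K) => /=; first exact: Qps.
    by have [_ _ _ E] := HQQ K KP; move: Kx; rewrite {1}E => -[].
  apply: card_le_trans (_ : `I_(size s) #<= `I_N)%card; last first.
    rewrite card_le_II; apply: leq_trans sP; rewrite size_filter.
    apply: leq_trans (count_size _ _) _; apply: leq_trans (size_undup _) _.
    by rewrite size_cat !size_map.
  rewrite (_ : [set` s] = nth set0 s @` `I_(size s)); first exact: card_image_le.
  apply/seteqP; split => [K /= KP|_ [i /= iP <-]]; last exact: mem_nth.
  by exists (index K s); rewrite /= ?index_mem// nth_index.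
(* The polynomial of a cube collects the [m K] of all rings having it as outer cube, minus those
   having it as removed cube. *)
pose M Q := \sum_(K <- P) (if Qp K == Q then m K else 0) -
            \sum_(K <- P) (if Qm K == Q then m K else 0).
have psum (F : set (euclid R d) -> mpoly.mpoly d R) :
    (forall K, K \in P -> polys l (F K)) -> polys l (\sum_(K <- P) F K).
  move=> HF; rewrite big_seq; apply: big_ind => //; first exact: polys0.
  exact: polysD.
exists M.
  move=> Q _; apply: polysB; apply: psum => K KP; (case: ifP => _; [exact: mP|exact: polys0]).
move=> x; rewrite -fsbig_seq//.
have pevals (F : set (euclid R d) -> mpoly.mpoly d R) :
    peval (\sum_(K <- P) F K) x = \sum_(K <- P) peval (F K) x.
  exact: (big_morph (fun g : mpoly.mpoly d R => peval g x) (fun a b => pevalD a b x) (peval0 x)).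
under eq_bigr => Q _ do rewrite pevalB !pevals mulrBl !mulr_suml.
rewrite sumrB exchange_big /= [X in _ = _ - X]exchange_big /= -sumrB /piecewise.
rewrite !big_seq; apply: eq_bigr => K KP.
have pick (A : set (euclid R d)) : \sum_(Q <- s) peval (if A == Q then m K else 0) x * \1_Q x =
    if A \in s then peval (m K) x * \1_A x else 0.
  rewrite -(@sum_pick s A (fun Q => peval (m K) x * \1_Q x) us); apply: eq_bigr => Q _; case: ifP => // _.
  by rewrite peval0 mul0r.
rewrite !pick Qps//.
have [_ hm [sub _] KE] := HQQ K KP.
have -> : (if Qm K \in s then peval (m K) x * \1_(Qm K) x else 0) = peval (m K) x * \1_(Qm K) x.
  case: ifPn => // nQ; have [->|Qm0] := eqVneq (Qm K) set0; first by rewrite indic0 mulr0.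
  by move: nQ; rewrite mem_filter Qm0 mem_undup mem_cat (map_f Qm KP) orbT.
rewrite -mulrBr; congr (_ * _); rewrite {1}KE !indicE in_setD -/(Qp K) -/(Qm K).
have [xm|xm] := boolP (x \in Qm K); last by rewrite andbT subr0.
by rewrite andbF (mem_set (sub _ (set_mem xm))) subrr.
Qed.

End assembly.

(** * The error on one ring *)

Section estimate.
Context {R : realType} {d : nat}.
Implicit Types (f : euclid R d -> R) (S K : set (euclid R d)) (q : \bar R)
  (P : seq (set (euclid R d))) (m : set (euclid R d) -> mpoly.mpoly d R).

Lemma is_dyadic_ring_measurable K : is_dyadic_ring K -> measurable K /\ K `<=` unit_cube.
Proof.
move=> [Q' [Q'' [[j [al [-> U]] ] H2 _ ->]]]; split; last by move=> x [/U].
apply: measurableD; first by apply: measurable_cube; exact: dyadic_cube_is_cube.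
case: H2 => [->//|[i [be [-> _]]]].
by apply: measurable_cube; exact: dyadic_cube_is_cube.
Qed.

(** A cube [K'] is chosen with best approximation above half the supremum over the cubes in [K];
    this factor 2 and the one from infimum to polynomial make the 4. The value [t] belongs to an
    actual cube inside [K], so that over disjoint rings the [t ^ p] can be summed by the seminorm.
    If all best approximations vanish, [t = 0]. *)
Lemma ring_pick k : (2 <= d)%N -> (0 < k)%N -> exists C : R, 1 <= C /\
  forall (p : R) q f K, 1 <= p -> (1 <= q)%E -> measurable_fun setT f ->
  (seminormV p q k f < +oo)%E -> is_dyadic_ring K ->
  exists (m : mpoly.mpoly d R) (t : R), [/\ polys k.-1 m, 0 <= t,
    (normLq q K (fun x => f x - peval m x)%R <= (C * t)%:E)%E &
    t = 0 \/ exists K', [/\ is_cube K', K' `<=` K & best_approx k f K' q = t%:E]].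
Proof.
move=> d2 k0; have [C [C1 HC]] := @dyadic_ring_approx R d k d2 k0.
exists (C * 4); split; first by lra.
move=> p q f K p1 q1 mf Vfin rK; have [mK KU] := is_dyadic_ring_measurable rK.
pose X := [set fine (best_approx k f K' q) | K' in [set K' | is_cube K' /\ K' `<=` K]].
have eV K' : is_cube K' -> K' `<=` K -> best_approx k f K' q \is a fin_num.
  move=> cK' K'K; rewrite ge0_fin_numE ?best_approx_ge0//.
  by apply: le_lt_trans (best_approx_le_seminormV q k f p1 cK' _) Vfin; exact: subset_trans KU.
have app (eta : R) : 0 <= eta ->
    (forall K', is_cube K' -> K' `<=` K -> (best_approx k f K' q <= eta%:E)%E) ->
    poly_approx k q f K (C * (2 * eta)).
  move=> eta0 H; apply: HC => //; first by rewrite mulr_ge0.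
  move=> a r r0 aK; have cK' : is_cube (cube a r) by exists a, r.
  apply: best_approx_approx => //.
  - exact: measurable_cube.
  - exact: subset_trans KU.
  - exact: H.
have [[K0 [cK0 K0K K0pos]]|H0] :=
    pselect (exists K', [/\ is_cube K', K' `<=` K & (0 < best_approx k f K' q)%E]).
  have K0X : X (fine (best_approx k f K0 q)) by exists K0.
  have supX : has_sup X.
    split; first by exists (fine (best_approx k f K0 q)).
    exists (fine (seminormV p q k f)) => _ [K' [cK' K'K] <-].
    apply: fine_le; [exact: eV| |].
      by rewrite ge0_fin_numE ?seminormV_ge0.
    by apply: best_approx_le_seminormV => //; exact: subset_trans KU.
  have sup0 : 0 < sup X.
    apply: lt_le_trans (ub_le_sup supX.2 K0X).
    by rewrite fine_gt0// K0pos -ge0_fin_numE ?best_approx_ge0 ?eV.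
  have [|_ [K' [cK' K'K] <-] lt] := @sup_adherent _ X (sup X / 2) _ supX.
    by rewrite divr_gt0.
  set t := fine _ in lt.
  have [||m [Pm Nm]] := app (2 * t).
  - by lra.
  - move=> K'' cK'' K''K; rewrite -(fineK (eV _ cK'' K''K)) lee_fin.
    apply: le_trans (ub_le_sup supX.2 _) _; first by exists K''.
    by lra.
  exists m, t; split => //; first by lra.
    by rewrite -mulrA (_ : 4 * t = 2 * (2 * t))//; ring.
  by right; exists K'; split => //; rewrite fineK// eV.
have [//||m [Pm Nm]] := app 0.
  move=> K' cK' K'K; rewrite leNgt; apply/negP => h; apply: H0.
  by exists K'.
by exists m, 0; split => //; [rewrite mulr0; rewrite !mulr0 in Nm|left].
Qed.

End estimate.

(** * The estimate with a prescribed number of rings *)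

Section main_estimate.
Context {R : realType} {d : nat}.
Implicit Types (f : euclid R d -> R) (S K : set (euclid R d)) (q : \bar R)
  (P : seq (set (euclid R d))) (m : set (euclid R d) -> mpoly.mpoly d R).

Lemma unit_cube_dyadic : unit_cube = dyadic_cube 0 [tuple 0 | i < d] :> set (euclid R d).
Proof.
rewrite unit_cube_box dyadic_cube_box; apply/seteqP; split => x Hx i; have := Hx i;
by rewrite /dyadic_corner tnth_mktuple mulr0 expr0 invr1 add0r.
Qed.

Lemma unit_cube_ring : is_dyadic_ring (unit_cube : set (euclid R d)).
Proof.
exists unit_cube, set0; rewrite setD0; split => //.
- by exists 0%N, [tuple 0 | i < d]; split => //; exact: unit_cube_dyadic.
- by left.
- split => // h; have [x] := @dyadic_cube_neq0 R d 0 [tuple 0 | i < d].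
  by rewrite -unit_cube_dyadic => /h.
Qed.

Lemma disj_family_unit_cube : disj_family (unit_cube : set (euclid R d)) [:: unit_cube].
Proof.
by apply: disj_family1; rewrite unit_cube_dyadic //; exact: dyadic_cube_neq0.
Qed.

Definition ring_approximation k q f P m (e : \bar R) := [/\ disj_family unit_cube P,
  forall K, K \in P -> is_dyadic_ring K,
  forall x : euclid R d, unit_cube x -> exists2 K, K \in P & K x,
  forall K, K \in P -> polys k.-1 (m K) &
  (normLq q unit_cube (fun x => f x - piecewise P m x)%R <= e)%E].

Lemma measurable_piecewise P m : (forall K, K \in P -> measurable K) ->
  measurable_fun setT (piecewise P m).
Proof.
move=> mP; rewrite /piecewise.
(* The conditional makes the summand measurable for every [K], also outside [P], as required for the
   sum. *)
rewrite (_ : (fun _ => _) = fun x => \sum_(K <- P) peval (m K) x * (if K \in P then \1_K x else 0)).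
  apply: measurable_sum => K; apply: measurable_funM; first exact: measurable_peval.
  by have [/mP mK|_] := boolP (K \in P) => //; exact: measurable_indic.
by apply/funext => x; rewrite !big_seq; apply: eq_bigr => K ->.
Qed.

Section norms_to_sum.
Variables (k : nat) (f : euclid R d -> R) (P : seq (set (euclid R d)))
  (m : set (euclid R d) -> mpoly.mpoly d R) (C : R) (t : set (euclid R d) -> R).
Hypotheses (mf : measurable_fun setT f) (fP : disj_family unit_cube P)
  (rP : forall K, K \in P -> is_dyadic_ring K)
  (cP : forall x : euclid R d, unit_cube x -> exists2 K, K \in P & K x)
  (C1 : 1 <= C) (t0 : forall K, 0 <= t K).

Let on_piece q K : K \in P ->
  normLq q K (fun x => f x - piecewise P m x)%R = normLq q K (fun x => f x - peval (m K) x)%R.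
Proof.
by move=> KP; apply: normLq_congr => x Kx; rewrite (piecewise_in m fP KP Kx).
Qed.

Lemma normLq_piecewise_fin (r : R) : 0 < r ->
  (forall K, K \in P -> (normLq r%:E K (fun x => f x - peval (m K) x)%R <= (C * t K)%:E)%E) ->
  (normLq r%:E unit_cube (fun x => f x - piecewise P m x)%R `^ r <=
    (C `^ r * \sum_(K <- P) t K `^ r)%:E)%E.
Proof.
move=> r0 Ht; have C0 : 0 <= C by apply: le_trans C1.
have mP K : K \in P -> measurable K by move=> /rP/is_dyadic_ring_measurable[].
have [uP _ _ dP] := fP.
rewrite -{1}(bigsetU_family fP cP).
rewrite (@normLq_bigU_fin _ _ r _ P id)//; last by apply: measurable_funB => //; exact: measurable_piecewise.
rewrite mulr_sumr -sumEFin big_seq [leRHS]big_seq; apply: lee_sum => K KP.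
rewrite on_piece// -powRM// -poweR_EFin.
apply: gt0_ler_poweR (Ht K KP); first exact: ltW.
  by rewrite in_itv /= leey normLq_ge0.
by rewrite in_itv /= leey lee_fin mulr_ge0.
Qed.

Lemma normLq_piecewise_infty (M : R) : 0 <= M ->
  (forall K, K \in P -> (normLq +oo K (fun x => f x - peval (m K) x)%R <= M%:E)%E) ->
  (normLq +oo unit_cube (fun x => f x - piecewise P m x)%R <= M%:E)%E.
Proof.
move=> M0 Ht; rewrite -{1}(bigsetU_family fP cP).
by apply: (@normLq_bigU_infty _ _ _ P id) => // K KP; rewrite on_piece//; exact: Ht.
Qed.

End norms_to_sum.

Lemma many_rings_approximation k : (2 <= d)%N -> (0 < k)%N -> exists C : R, 1 <= C /\
  forall (p : R) q f (M : nat), 1 <= p -> (p%:E < q)%E -> measurable_fun setT f ->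
  (normLq q unit_cube f < +oo)%E -> (q = +oo%E -> unif_continuous_on unit_cube f) ->
  (0 < M)%N -> (0 < seminormV p q k f)%E -> (seminormV p q k f < +oo)%E ->
  exists P m, (size P <= (2 ^ d.+1).+1 * M)%N /\
    ring_approximation k q f P m
      ((C * M%:R `^ (- (p^-1 - fine (q^-1)%E)))%:E * seminormV p q k f)%E.
Proof.
move=> d2 k0; have [C [C1 HC]] := @ring_pick R d k d2 k0.
exists C; split => // p q f M p1 pq mf ffin uc M0 V0 Vfin.
have C0 : 0 <= C by lra.
have p0 : 0 < p by lra.
have pn0 : p != 0 by rewrite gt_eqF.
have q1 : (1 <= q)%E by apply: ltW; apply: le_lt_trans pq; rewrite lee_fin.
have MR : (0 : R) < M%:R by rewrite ltr0n.
set V := seminormV p q k f in V0 Vfin *.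
have Vf : V \is a fin_num by rewrite ge0_fin_numE// ltW.
pose v := fine V; have vE : V = v%:E by rewrite fineK.
have v0 : 0 < v by rewrite -lte_fin -vE.
pose eps := v * M%:R `^ (- p^-1).
have eps0 : 0 < eps by rewrite mulr_gt0// powR_gt0.
have epsp : eps `^ p = v `^ p * M%:R^-1.
  by rewrite powRM ?powR_ge0 ?(ltW v0)// -powRrM mulNr mulVf// powR_inv1// ltW.
have sumV := @sum_best_approx_le R d p q k f p1.
have eV K : is_cube K -> K `<=` unit_cube -> best_approx k f K q \is a fin_num.
  move=> cK KU; rewrite ge0_fin_numE ?best_approx_ge0//.
  exact: le_lt_trans (best_approx_le_seminormV q k f p1 cK KU) Vfin.
have [J HJ] : exists J, forall alpha K, (dyadic_cube J alpha : set (euclid R d)) `<=` unit_cube ->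
    is_cube K -> K `<=` dyadic_cube J alpha -> (best_approx k f K q <= eps%:E)%E.
  move: q1 pq uc ffin; case: (q) => [r||//] q1 pq uc ffin.
    by apply: best_approx_small_fin => //; exact: ltnW.
  exact: best_approx_small_infty (uc erefl) _.
pose big K := (eps%:E < best_approx k f K q)%E.
have Jgood alpha : (dyadic_cube J alpha : set (euclid R d)) `<=` unit_cube ->
    ~ bad big (dyadic_cube J alpha).
  by move=> DU [K [cK KD]]; rewrite /big ltNge (HJ alpha).
have U0 : (dyadic_cube 0 [tuple 0 | i < d] : set (euclid R d)) `<=` unit_cube.
  by rewrite -unit_cube_dyadic.
have [L [P]] := exists_good_partition Jgood (leq0n J) (leqnn _) U0.
rewrite -unit_cube_dyadic => -[[fL HL] [fP HP] cP cnt].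
(* Each of the [size L] disjoint cubes contributes at least [eps ^ p = v ^ p / M] to a sum of at
   most [v ^ p]. *)
have LM : (size L <= M)%N.
  have := sumV L fL (fun K KL => (HL K KL).1); rewrite -/V vE poweR_EFin => h.
  have {}h : ((\sum_(K <- L) eps `^ p)%:E <= (v `^ p)%:E)%E.
    apply: le_trans h; rewrite -sumEFin big_seq [leRHS]big_seq; apply: lee_sum => K KL.
    rewrite -poweR_EFin; apply: gt0_ler_poweR; first exact: ltW.
    - by rewrite in_itv /= leey lee_fin ltW.
    - by rewrite in_itv /= leey best_approx_ge0.
    - by apply: ltW; have [] := HL K KL.
  move: h; rewrite lee_fin big_const_seq count_predT iter_addr_0 epsp -[_ *+ size L]mulr_natr.
  rewrite -mulrA -[leRHS]mulr1 ler_pM2l ?powR_gt0// ler_pdivrMl// mulr1.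
  by rewrite ler_nat.
have /choice[mt Hmt] : forall K, exists mt : mpoly.mpoly d R * R * set (euclid R d), K \in P ->
    [/\ polys k.-1 mt.1.1, 0 <= mt.1.2,
    (normLq q K (fun x => f x - peval mt.1.1 x)%R <= (C * mt.1.2)%:E)%E &
    mt.1.2 = 0 \/ [/\ is_cube mt.2, mt.2 `<=` K & best_approx k f mt.2 q = mt.1.2%:E]].
  move=> K; have [KP|_] := boolP (K \in P); last by exists (0, 0, set0).
  have [m [t [Pm t0 Nm Ht]]] := HC p q f K p1 q1 mf Vfin (HP K KP).1.
  case: Ht => [tE|[K' HK']].
    by exists (m, t, set0) => _; split => //; left.
  by exists (m, t, K') => _; split => //; right.
pose m K := (mt K).1.1; pose t K := if K \in P then (mt K).1.2 else 0; pose K' K := (mt K).2.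
have tE K : K \in P -> t K = (mt K).1.2 by rewrite /t => ->.
have t0 K : 0 <= t K by rewrite /t; case: ifPn => // /Hmt[].
have rP K : K \in P -> is_dyadic_ring K by move=> /HP[].
have PU K : K \in P -> K `<=` unit_cube by move=> /rP/is_dyadic_ring_measurable[].
have Hm K : K \in P -> (normLq q K (fun x => f x - peval (m K) x)%R <= (C * t K)%:E)%E.
  by move=> KP; rewrite tE//; have [] := Hmt K KP.
have tK' K : K \in P -> t K != 0 ->
    [/\ is_cube (K' K), K' K `<=` K & best_approx k f (K' K) q = (t K)%:E].
  move=> KP tn0; rewrite tE//; have [_ _ _ [t00|//]] := Hmt K KP.
  by move: tn0; rewrite tE// t00 eqxx.
have teps K : K \in P -> t K <= eps.
  move=> KP; have [->|tn0] := eqVneq (t K) 0; first exact: ltW.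
  have [cK' K'K eE] := tK' K KP tn0; rewrite leNgt; apply/negP => h.
  by have [_] := HP K KP; apply; exists (K' K); split => //; rewrite /big eE lte_fin.
(* The witness cubes lie in disjoint rings, hence form a family admissible for the seminorm; rings
   with [t K = 0] add nothing and are dropped. *)
have sumt : \sum_(K <- P) t K `^ p <= v `^ p.
  pose P' := [seq K <- P | t K != 0].
  have P'P K : K \in P' -> K \in P /\ t K != 0 by rewrite mem_filter => /andP[].
  have [uP _ nP dP] := fP.
  have injK' : {in P' &, injective K'}.
    move=> K1 K2 /P'P[K1P t1] /P'P[K2P t2] E.
    have [cK1 K1K _] := tK' _ K1P t1; have [_ K2K _] := tK' _ K2P t2.
    have [x Kx] := cube_neq0 cK1; apply: (dP x) => //; first exact: K1K.
    by apply: K2K; rewrite -E.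
  have := sumV [seq K' K | K <- P']; rewrite -/V vE poweR_EFin => h.
  rewrite -lee_fin -sumEFin; apply: le_trans (h _ _).
  - rewrite big_map /P' big_filter big_mkcond [leRHS]big_mkcond /= big_seq [leRHS]big_seq.
    apply: lee_sum => K KP; have [->|tn0] := eqVneq (t K) 0; first by rewrite powR0.
    by have [_ _ ->] := tK' K KP tn0; rewrite poweR_EFin.
  - split.
    + by rewrite map_inj_in_uniq// filter_uniq.
    + move=> _ /mapP[K /P'P[KP tn0] ->]; have [_ K'K _] := tK' K KP tn0.
      exact: subset_trans (PU _ KP).
    + move=> _ /mapP[K /P'P[KP tn0] ->]; have [cK' _ _] := tK' K KP tn0.
      exact: cube_neq0.
    + move=> x _ _ /mapP[K1 /P'P[K1P t1] ->] /mapP[K2 /P'P[K2P t2] ->] K1x K2x.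
      have [_ K1K _] := tK' _ K1P t1; have [_ K2K _] := tK' _ K2P t2.
      by congr K'; apply: (dP x) => //; [exact: K1K|exact: K2K].
  - by move=> _ /mapP[K /P'P[KP tn0] ->]; have [cK' _ _] := tK' K KP tn0.
exists P, m; split.
  case: cnt => [[_ ->]|]; first by rewrite muln_gt0 /= M0.
  move=> h; apply: leq_trans (_ : (2 ^ d.+1).+1 * size L <= _)%N; last by rewrite leq_mul2l LM orbT.
  by apply: leq_trans h; exact: leq_addr.
split => //; first by move=> K KP; rewrite /m; have [] := Hmt K KP.
rewrite vE -EFinM.
move: q1 pq Hm; case: (q) => [r||//] q1 pq Hm; last first.
  apply: normLq_piecewise_infty => //.
    by rewrite mulr_ge0 ?(ltW v0)// mulr_ge0// powR_ge0.
  move=> K KP; apply: le_trans (Hm K KP) _; rewrite lee_fin invey subr0.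
  by rewrite -mulrA ler_wpM2l// mulrC teps.
have r1 : 1 <= r by rewrite -lee_fin.
have r0 : 0 < r by lra.
have rn0 : r != 0 by rewrite gt_eqF.
have pr : p < r by rewrite -lte_fin.
rewrite inver (negbTE rn0) /=.
have N0 := normLq_ge0 r%:E unit_cube (fun x => f x - piecewise P m x).
have := normLq_piecewise_fin mf fP rP cP C1 t0 r0 Hm.
set X := C * _ * v => h.
have X0 : 0 <= X by rewrite mulr_ge0 ?(ltW v0)// mulr_ge0// powR_ge0.
(* The exponents of [M] match because [(r - p) / p = r * (p^-1 - r^-1)]. *)
have XE : X `^ r = C `^ r * (eps `^ (r - p) * v `^ p).
  rewrite /X /eps !powRM ?powR_ge0 ?mulr_ge0 ?powR_ge0 ?(ltW v0)//.
  rewrite -!powRrM -!mulrA; congr (_ * _).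
  have -> : v `^ r = v `^ (r - p) * v `^ p.
    by rewrite -powRD ?subrK// (gt_eqF v0) implybT.
  rewrite [RHS]mulrCA; congr (_ `^ _ * _); field.
  by rewrite pn0.
have {}h : (normLq r%:E unit_cube (fun x => f x - piecewise P m x)%R `^ r <= (X `^ r)%:E)%E.
  apply: le_trans h _; rewrite lee_fin XE ler_wpM2l ?powR_ge0//.
  apply: le_trans (_ : eps `^ (r - p) * \sum_(K <- P) t K `^ p <= _); last first.
    by rewrite ler_wpM2l ?powR_ge0.
  rewrite mulr_sumr big_seq [leRHS]big_seq; apply: ler_sum => K KP.
  have -> : t K `^ r = t K `^ (r - p) * t K `^ p.
    by rewrite -powRD ?subrK// (negbTE rn0).
  rewrite ler_wpM2r ?powR_ge0// ge0_ler_powR ?nnegrE ?(ltW eps0)// ?teps//.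
  by rewrite subr_ge0 ltW.
rewrite -[leLHS]poweRe1// -(mulfV rn0) poweRrM.
have -> : X%:E = ((X `^ r)%:E `^ r^-1)%E by rewrite poweR_EFin -powRrM mulfV// powRr1.
apply: gt0_ler_poweR h; first by rewrite invr_ge0 ltW.
  by rewrite in_itv /= leey poweR_ge0.
by rewrite in_itv /= leey lee_fin powR_ge0.
Qed.

End main_estimate.

(** * From many rings to all [N] *)

Section final.
Context {R : realType} {d : nat}.
Implicit Types (f g : euclid R d -> R) (S K : set (euclid R d)) (q : \bar R).

Lemma best_approx_congr k q S f g : (forall x, S x -> f x = g x) ->
  best_approx k f S q = best_approx k g S q.
Proof.
move=> fg; congr ereal_inf; apply: eq_imagel => m _.
by apply: normLq_congr => x Sx; rewrite fg.
Qed.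

Lemma seminormV_congr p q k f g : (forall x, unit_cube x -> f x = g x) ->
  seminormV p q k f = seminormV p q k g.
Proof.
move=> fg; congr ereal_sup; apply: eq_imagel => D [DU _]; congr (_ `^ _)%E.
apply: eq_esum => Q /DU[_ QU]; congr (_ `^ _)%E.
by apply: best_approx_congr => x /QU; exact: fg.
Qed.

(** The fallback for small [N], where a bounded loss is harmless, and for seminorm 0, where the
    threshold would be 0. *)
Lemma one_ring_approximation k p q f : (0 < k)%N -> 1 <= p -> (1 <= q)%E ->
  measurable_fun setT f -> (seminormV p q k f < +oo)%E ->
  exists m, ring_approximation k q f [:: unit_cube] m (2%:E * seminormV p q k f)%E.
Proof.
move=> k0 p1 q1 mf Vfin.
have V0 := seminormV_ge0 p q k f.
have Vf : seminormV p q k f \is a fin_num by rewrite ge0_fin_numE.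
have U := @disj_family_unit_cube R d.
have cU : is_cube (unit_cube : set (euclid R d)).
  by rewrite unit_cube_dyadic; exact: dyadic_cube_is_cube.
have := best_approx_le_seminormV q k f p1 cU (@subset_refl _ _).
rewrite -(fineK Vf) => /(best_approx_approx q1 measurable_unit_cube (@subset_refl _ _) mf
  (fine_ge0 V0))[m [Pm Nm]].
 exists (fun=> m); split => //.
- by move=> K; rewrite mem_seq1 => /eqP ->; exact: unit_cube_ring.
- by move=> x Ux; exists unit_cube; rewrite ?mem_seq1.
- apply: le_trans Nm; rewrite le_eqVlt; apply/orP; left; apply/eqP.
  apply: normLq_congr => x Ux.
  by rewrite (@piecewise_in _ _ [:: unit_cube] _ unit_cube unit_cube)// mem_seq1.
Qed.

End final.

Theorem theorem2p1 (R : realType) (d k : nat) (d2 : (2 <= d)%N)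
    (k1 : (1 <= k)%N) :
  exists c : R, 0 < c /\
    forall (p : R) (q : \bar R) (s : R),
      1 <= p -> (p%:E < q)%E ->
      s = d%:R * (p^-1 - fine (q^-1)%E) ->
      0 < s -> s <= k%:R ->
    forall f : euclid R d -> R, spaceV p q k f ->
      (q = +oo%E -> unif_continuous_on unit_cube f) ->
    forall N : nat, (1 <= N)%N ->
      (exists2 D, dyadic_covering N D &
       exists2 g, piecewise_polys k.-1 D g &
         (normLq q unit_cube (fun x => (f x - g x)%R)
          <= (c * N%:R `^ (- (s / d%:R)))%:E * seminormV p q k f)%E)
      /\
      (exists2 D, ring_partition N D &
       exists2 g, piecewise_polys k.-1 D g &
         (normLq q unit_cube (fun x => (f x - g x)%R)
          <= (c * N%:R `^ (- (s / d%:R)))%:E * seminormV p q k f)%E).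
Proof.
have [C [C1 HC]] := @many_rings_approximation R d k d2 k1.
(* [(2 ^ d.+1).+1] rings for each unit of [M], doubled because a ring costs two cubes in the
   covering. *)
pose A := (2 * (2 ^ d.+1).+1)%N.
have A0 : (0 < A)%N by rewrite muln_gt0.
have AR : 1 <= A%:R :> R by rewrite ler1n.
exists (2 * A%:R * (C + 1)); split; first by rewrite !mulr_gt0//; lra.
move=> p q s p1 pq sE s0 _ f [mf ffin Vfin] uc N N1.
have d0 : d%:R != 0 :> R by rewrite pnatr_eq0 -lt0n ltnW.
have q1 : (1 <= q)%E by apply: ltW; apply: le_lt_trans pq; rewrite lee_fin.
set lam := s / d%:R.
have lamE : lam = p^-1 - fine (q^-1)%E by rewrite /lam sE mulrC mulKf.
have lam0 : 0 < lam by rewrite divr_gt0// ltr0n ltnW.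
(* Powers with exponent [lam] of numbers at least 1 are bounded by the numbers themselves, which
   keeps the constant free of [p] and [q]. *)
have lam1 : lam <= 1.
  have : p^-1 <= 1 by rewrite invf_le1//; lra.
  have : 0 <= fine (q^-1)%E by apply: fine_ge0; rewrite inve_ge0 (le_trans _ q1).
  by rewrite lamE; lra.
(* [f] is measurable on the unit cube only; its extension by 0 is measurable everywhere and agrees
   with it there. *)
pose F := f \_ unit_cube.
have fF x : unit_cube x -> f x = F x by move=> Ux; rewrite /F patchE mem_set.
have mF : measurable_fun setT F by apply/(measurable_restrictT _ measurable_unit_cube).
have VE := seminormV_congr p q k fF.
have NF : normLq q unit_cube F = normLq q unit_cube f by apply/esym/normLq_congr.
have ucF : q = +oo%E -> unif_continuous_on unit_cube F.
  move=> /uc h e /h[dl dl0 H]; exists dl => // x y Ux Uy xy.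
  by rewrite -!fF//; exact: H.
have V0 := seminormV_ge0 p q k F.
have NR : 1 <= N%:R :> R by rewrite ler1n.
(* The single piece is kept apart: the unit cube is a covering by one cube, valid even for [N = 1],
   whereas passing from rings to cubes doubles the number. *)
have [P [m [sP [fP rP cP mP le]]]] : exists P m, (P = [:: unit_cube] \/ (size P + size P <= N)%N) /\
    ring_approximation k q F P m ((2 * A%:R * (C + 1) * N%:R `^ (- lam))%:E * seminormV p q k F)%E.
  have Nlam0 : 0 <= N%:R `^ (- lam) by exact: powR_ge0.
  have CA : 0 <= 2 * A%:R * (C + 1) by rewrite !mulr_ge0//; lra.
  have VFfin : (seminormV p q k F < +oo)%E by rewrite -VE.
  have [NAV|] := pselect ((N < A)%N \/ seminormV p q k F = 0%E).
    have [m [fP rP cP mP le]] := @one_ring_approximation R d k p q F k1 p1 q1 mF VFfin.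
    exists [:: unit_cube], m; split; first by left.
    split => //; apply: le_trans le _.
    case: NAV => [NA|->]; last by rewrite !mule0.
    apply: lee_wpmul2r => //; rewrite lee_fin.
    have NAinv : A%:R^-1 <= N%:R `^ (- lam).
      rewrite powRN lef_pV2 ?posrE ?powR_gt0 ?ltr0n//.
      apply: le_trans (ler1_powR NR lam1) _.
      by rewrite ler_nat ltnW.
    apply: le_trans (_ : 2 * A%:R * (C + 1) * A%:R^-1 <= _); last by rewrite ler_wpM2l.
    by rewrite mulrAC mulfK ?gt_eqF ?ltr0n//; lra.
  move=> /not_orP[/negP]; rewrite -leqNgt => AN Vn0.
  pose M := (N %/ A)%N.
  have M0 : (0 < M)%N by rewrite divn_gt0.
  have VFpos : (0 < seminormV p q k F)%E by rewrite lt0e V0 andbT; apply/eqP.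
  have [|P [m [sP [fP rP cP mP le]]]] := HC p q F M p1 pq mF _ ucF M0 VFpos VFfin; first by rewrite NF.
  exists P, m; split.
    right; rewrite addnn -mul2n; apply: leq_trans (leq_mul (leqnn 2) sP) _.
    by rewrite mulnA mulnC leq_trunc_div.
  split => //; apply: le_trans le _; apply: lee_wpmul2r => //; rewrite lee_fin -lamE.
  (* Rounding down loses at most a factor 2: [N < A * (M + 1) <= 2 * A * M]. *)
  have NM : N%:R <= 2 * A%:R * M%:R :> R.
    rewrite -!natrM ler_nat -mulnA mul2n -addnn.
    have := ltn_ceil N A0; rewrite -/M mulSn mulnC => /ltnW/leq_trans; apply.
    by rewrite leq_add2r leq_pmulr.
  have A2 : 0 < 2 * A%:R :> R by lra.
  have h1 : M%:R `^ (- lam) <= 2 * A%:R * N%:R `^ (- lam).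
    rewrite !powRN ler_pdivlMr ?powR_gt0 ?ltr0n// mulrC ler_pdivrMr ?powR_gt0 ?ltr0n//.
    apply: le_trans (_ : (2 * A%:R * M%:R) `^ lam <= _).
      have lam_ge0 : 0 <= lam by exact: ltW.
      by apply: (ge0_ler_powR lam_ge0 _ _ NM); rewrite nnegrE ?mulr_ge0.
    rewrite [leLHS]powRM ?ler0n ?(ltW A2)// ler_wpM2r ?powR_ge0// ler1_powR//.
    by lra.
  apply: le_trans (ler_wpM2l _ h1) _; first by lra.
  rewrite mulrA ler_wpM2r// mulrC ler_wpM2l//; lra.
have [RP PP] : ring_partition N [set` P] /\ piecewise_polys k.-1 [set` P] (piecewise P m).
  apply: partition_piecewise => //; case: sP => [->//|]; exact/leq_trans/leq_addr.
have ble : (normLq q unit_cube (fun x => (f x - piecewise P m x)%R) <=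
    (2 * A%:R * (C + 1) * N%:R `^ (- lam))%:E * seminormV p q k f)%E.
  rewrite VE; apply: le_trans le; rewrite le_eqVlt; apply/orP; left; apply/eqP.
  by apply: normLq_congr => x Ux; rewrite fF.
split; last by exists [set` P] => //; exists (piecewise P m).
case: sP => [PE|sP]; last first.
  by have [D HD HP] := covering_piecewise fP rP cP mP sP; exists D => //; exists (piecewise P m).
exists [set` P]; last by exists (piecewise P m).
have [_ h1 _ h2] := RP; split => // Q; rewrite PE /= mem_seq1 => /eqP ->.
exists 0%N, [tuple 0 | i < d]; split => //; exact: unit_cube_dyadic.
Qed.
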